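(* Let $C=ce^{i\zeta}$ with $0\le c<1$, $\zeta\in\mathbb{R}$, let $0<R<1-c$, and let $B_{C,R}\subset\mathbb{D}$ be the open ball with centre $C$ and radius $R$. Denote by $A'$ the matrix representation of $\mathcal{R}'(1)[\chi_{B_{C,R}}]$, i.e. $$A'_{n,m}\equiv\langle\mathcal{R}'(1)[\chi_{B_{C,R}}]f_m,f_n\rangle,\qquad n,m\in\mathbb{Z}\setminus\{0\}.$$ Then: (i) $A'$ is Hermitian, i.e. $A'=(A')^*$. (ii) $A'$ is centrohermitian, i.e. $A'_{n,m}=\overline{A'_{-n,-m}}$ for all $n,m\in\mathbb{Z}\setminus\{0\}$. (iii) $A'$ is block diagonal: $A'_{n,m}=0$ for $n<0,\ m>0$ and for $n>0,\ m<0$. (iv) For $n>0$ and $m>0$, $$A'_{n,m}=-e^{i(m-n)\zeta}\sum_{k=0}^{\min\{n,m\}-1}\frac{1}{k+1}\binom{m-1}{k}\binom{n-1}{k}c^{m+n-2k-2}R^{2k+2}.$$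
   Context: $\mathbb{D}$ is the open unit disk in $\mathbb{R}^2\cong\mathbb{C}$. $\langle f,g\rangle=\int_{\partial\mathbb{D}}f\overline{g}\,ds$ is the $L^2(\partial\mathbb{D})$ inner product, $L^2_\diamond(\partial\mathbb{D})=\{w\in L^2(\partial\mathbb{D}):\int_{\partial\mathbb{D}}w\,ds=0\}$, and $f_n(\theta)=\frac{1}{\sqrt{2\pi}}e^{in\theta}$, $n\in\mathbb{Z}\setminus\{0\}$, is the Fourier basis of $L^2_\diamond(\partial\mathbb{D})$. $\chi_B$ is the characteristic function of $B$. $\mathcal{R}'(1)$ is the Fréchet derivative at the constant conductivity $1$ of the map $\gamma\mapsto\mathcal{R}(\gamma)$ sending a conductivity to its Neumann-to-Dirichlet map. For $\eta\in L^\infty(\mathbb{D})$, $\mathcal{R}'(1)[\eta]$ is the bounded operator on $L^2_\diamond(\partial\mathbb{D})$ given by $$\langle\mathcal{R}'(1)[\eta]f,g\rangle=-\int_{\mathbb{D}}\eta\,\nabla w_f\cdot\overline{\nabla w_g}\,dx,\qquad f,g\in L^2_\diamond(\partial\mathbb{D}),$$ where, for $h\in L^2_\diamond(\partial\mathbb{D})$, $w_h\in H^1(\mathbb{D})$ is the unique (weak) solution of $\Delta w_h=0$ in $\mathbb{D}$, $\nu\cdot\nabla w_h=h$ on $\partial\mathbb{D}$ ($\nu$ the outward unit normal), $\int_{\partial\mathbb{D}}w_h\,ds=0$. The convention $0^0=1$ is used. *)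

(* Defs.v *)
From HB Require Import structures.
From mathcomp Require Import all_boot all_order all_algebra.
From mathcomp Require Import complex.
From mathcomp Require Import all_classical all_reals all_analysis.

Set Implicit Arguments.
Unset Strict Implicit.
Unset Printing Implicit Defensive.

Import Order.TTheory GRing.Theory Num.Theory.
Import numFieldNormedType.Exports.
Import Normc.

Local Open Scope classical_set_scope.
Local Open Scope ring_scope.
Local Open Scope complex_scope.

Section ComplexIntegration.
Context d (T : measurableType d) (R : realType).
Variables (mu : {measure set T -> \bar R}) (D : set T).
Implicit Types f g : T -> R[i].

Definition cintegral f : R[i] :=
  Rintegral mu D (fun x => complex.Re (f x))
    +i* Rintegral mu D (fun x => complex.Im (f x)).

Definition inL2 f : Prop :=
  [/\ measurable_fun D (fun x => complex.Re (f x)),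
      measurable_fun D (fun x => complex.Im (f x)) &
      mu.-integrable D (fun x => (normc (f x) ^+ 2)%:E)].

Definition L2norm f : R := Num.sqrt (Rintegral mu D (fun x => normc (f x) ^+ 2)).

(* Linear in the first argument, antilinear in the second. *)
Definition L2inner f g : R[i] := cintegral (fun x => f x * (g x)^*).

End ComplexIntegration.

Section Plane.
Context {R : realType}.
Local Notation plane := (R * R)%type.

Definition plane_measure :
    {measure set (measurableTypeR R * measurableTypeR R) -> \bar R} :=
  (@lebesgue_measure R \x @lebesgue_measure R)%E.

Definition toC (p : plane) : R[i] := p.1 +i* p.2.

(* The library's [ball] on [R * R] is the sup-norm ball, hence this one. *)
Definition disk (C : R[i]) (r : R) : set plane := [set p | normc (toC p - C) < r].

Definition unit_disk : set plane := disk 0 1.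

Definition e1 : plane := (1, 0).
Definition e2 : plane := (0, 1).

Fixpoint Ck (k : nat) (u : plane -> R) : Prop :=
  if k is k'.+1 then
    [/\ forall p, derivable u p e1, forall p, derivable u p e2,
        Ck k' (fun p => 'D_e1 u p) & Ck k' (fun p => 'D_e2 u p)]
  else continuous u.

Definition smooth (u : plane -> R) : Prop := forall k, Ck k u.

Definition test_function (D : set plane) (phi : plane -> R) : Prop :=
  smooth phi /\
  exists K : set plane, [/\ compact K, K `<=` D & forall p, ~ K p -> phi p = 0].

Definition weak_partial (D : set plane) (e : plane) (w g : plane -> R[i]) : Prop :=
  forall phi, test_function D phi ->
    cintegral plane_measure D (fun p => w p * ('D_e phi p)%:C) =
    - cintegral plane_measure D (fun p => g p * (phi p)%:C).

(* [w] belongs to H^1(D) and [G] represents its weak gradient. *)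
Definition inH1 (D : set plane) (w : plane -> R[i]) (G : plane -> R[i] * R[i]) : Prop :=
  [/\ inL2 plane_measure D w,
      inL2 plane_measure D (fun p => (G p).1),
      inL2 plane_measure D (fun p => (G p).2),
      weak_partial D e1 w (fun p => (G p).1) &
      weak_partial D e2 w (fun p => (G p).2)].

Definition cdot (a b : R[i] * R[i]) : R[i] := a.1 * b.1^* + a.2 * b.2^*.

Definition csmooth (u : plane -> R[i]) : Prop :=
  smooth (fun p => complex.Re (u p)) /\ smooth (fun p => complex.Im (u p)).

Definition cpartial (e : plane) (u : plane -> R[i]) (p : plane) : R[i] :=
  'D_e (fun q => complex.Re (u q)) p +i* 'D_e (fun q => complex.Im (u q)) p.

End Plane.

Section UnitCircle.
Context {R : realType}.
Local Notation plane := (R * R)%type.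

(* Functions on the unit circle are functions of the angle t in [0, 2 pi], for
   which arc length is Lebesgue measure; values at other t are irrelevant. *)
Definition angles : set R := `[0, 2 * pi].

Definition circle_point (t : R) : plane := (cos t, sin t).

Definition cis (t : R) : R[i] := cos t +i* sin t.

Definition circle_int (f : R -> R[i]) : R[i] := cintegral lebesgue_measure angles f.
Definition circle_inner (f g : R -> R[i]) : R[i] := L2inner lebesgue_measure angles f g.
Definition circle_norm (f : R -> R[i]) : R := L2norm lebesgue_measure angles f.
Definition circle_L2 (f : R -> R[i]) : Prop := inL2 lebesgue_measure angles f.

Definition L2diamond (f : R -> R[i]) : Prop := circle_L2 f /\ circle_int f = 0.

Definition fourier (n : int) (t : R) : R[i] :=
  ((Num.sqrt (2 * pi))^-1)%:C * cis (n%:~R * t).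

(* [h] is the trace on the unit circle of [w] in H^1 of the unit disk with weak
   gradient [G]: the trace operator is the extension by continuity of the
   restriction of functions smooth up to the boundary. For [w] in H^1 all the
   integrals below are finite, so that [L2norm] is not the default value of
   [Rintegral]. *)
Definition is_trace (w : plane -> R[i]) (G : plane -> R[i] * R[i])
    (h : R -> R[i]) : Prop :=
  circle_L2 h /\
  exists u : nat -> plane -> R[i],
    [/\ forall k, csmooth (u k),
        L2norm plane_measure unit_disk (fun p => u k p - w p) @[k --> \oo] --> (0 : R),
        L2norm plane_measure unit_disk (fun p => cpartial e1 (u k) p - (G p).1)
          @[k --> \oo] --> (0 : R),
        L2norm plane_measure unit_disk (fun p => cpartial e2 (u k) p - (G p).2)
          @[k --> \oo] --> (0 : R) &
        circle_norm (fun t => u k (circle_point t) - h t) @[k --> \oo] --> (0 : R)].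

(* [w] in H^1, with weak gradient [G], is the weak solution of the Neumann
   problem for the Laplacian in the unit disk with boundary data [h] and
   zero boundary mean. *)
Definition neumann_solution (h : R -> R[i])
    (w : plane -> R[i]) (G : plane -> R[i] * R[i]) : Prop :=
  [/\ inH1 unit_disk w G,
      (forall v Gv tv, inH1 unit_disk v Gv -> is_trace v Gv tv ->
        cintegral plane_measure unit_disk (fun p => cdot (G p) (Gv p)) =
        circle_inner h tv) &
      exists2 tw, is_trace w G tw & circle_int tw = 0].

(* Bounded operators on [L2diamond], acting on representatives; linearity is
   almost everywhere and, with boundedness, makes the operator compatible with
   almost everywhere equality. *)
Definition bounded_operator (T : (R -> R[i]) -> R -> R[i]) : Prop :=
  [/\ forall f, L2diamond f -> L2diamond (T f),
      forall (a : R[i]) f g, L2diamond f -> L2diamond g ->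
        {ae lebesgue_measure, forall t, angles t ->
          T (fun s => a * f s + g s) t = a * T f t + T g t} &
      exists K : R, forall f, L2diamond f -> circle_norm (T f) <= K * circle_norm f].

(* [T] is the derivative, at the constant conductivity 1 and in direction [eta],
   of the map from conductivities to Neumann-to-Dirichlet operators, for [eta]
   essentially bounded. The weak solutions [wf] and [wg] exist and are unique, so
   this identity determines the sesquilinear form of [T] on all of [L2diamond],
   hence [T] itself up to almost everywhere equality. *)
Definition is_NtD_derivative (eta : plane -> R)
    (T : (R -> R[i]) -> R -> R[i]) : Prop :=
  bounded_operator T /\
  forall f g wf Gf wg Gg, L2diamond f -> L2diamond g ->
    neumann_solution f wf Gf -> neumann_solution g wg Gg ->
    circle_inner (T f) g =
    - cintegral plane_measure unit_disk (fun p => (eta p)%:C * cdot (Gf p) (Gg p)).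

Definition matrix_rep (T : (R -> R[i]) -> R -> R[i]) (n m : int) : R[i] :=
  circle_inner (T (fourier m)) (fourier n).

End UnitCircle.

(* Main.v *)
(* The function z^n / n, n > 0, solves the Neumann problem with boundary data
   e^(i n t); its conjugate solves the one with data e^(- i n t). The gradients
   are z^(n-1) (1, i) and conj(z)^(n-1) (1, -i), which makes the symmetries of
   the matrix pointwise identities of the integrand and reduces its entries to
   moments of z^(m-1) conj(z)^(n-1) over the disk B.
   Everything else is Green's identity on a disk, for the operator
   dbar = d/dx + i d/dy: applied to z^(n-1) conj(u), which satisfies
   dbar z^(n-1) = 0, it is the weak formulation of the Neumann problem; applied
   to z^(m-1) conj(z)^n it turns 2 n times the moment into an integral over the
   circle z = C + r e^(i t), where the binomial theorem and the orthogonality of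
   the exponentials leave one finite sum. *)
Require Import Defs.
From HB Require Import structures.
From mathcomp Require Import all_boot all_order all_algebra.
From mathcomp Require Import complex.
From mathcomp Require Import all_classical all_reals all_analysis.
From mathcomp Require Import measurable_realfun zify ring lra.

Set Implicit Arguments.
Unset Strict Implicit.
Unset Printing Implicit Defensive.

Import Order.TTheory GRing.Theory Num.Theory.
Import numFieldNormedType.Exports.
Import Normc.

Local Open Scope classical_set_scope.
Local Open Scope ring_scope.
Local Open Scope complex_scope.

(** The identity that characterizes the derivative is available for every pair of weak solutions, so
    it suffices to exhibit one solution for each Fourier mode. The obstacle is that a weak solution
    must be tested against every [v] in H^1 that has a trace, and such a [v] is known only through
    smooth functions converging to it in L^2 norms. Green's identity is therefore proved for smooth
    functions only and carried to the limit; this works because the monomial gradients and the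
    boundary data are bounded, so that pairing with them is continuous for the L^2 norm.

    Green's identity itself is one-dimensional: Fubini, the fundamental theorem of calculus on
    chords, and the substitution x = a + rho cos t. No polar coordinates in the plane occur, even
    for a disk that is not centred at 0.

    A sign [s], equal to 1 or - 1, treats z and its conjugate in a single argument. The factor 1 /
    (k + 1) of the final formula comes from the identity C(n, k+1) = n / (k+1) C(n-1, k), applied to
    the power conj(z)^n that is raised by one in order to integrate in conj(z). *)

Lemma continuous_fst (U V : topologicalType) : continuous (@fst U V).
Proof. by move=> [x y]; exact: cvg_fst. Qed.

Lemma continuous_snd (U V : topologicalType) : continuous (@snd U V).
Proof. by move=> [x y]; exact: cvg_snd. Qed.

Lemma continuous_pair (T U V : topologicalType) (f : T -> U) (g : T -> V) :
  continuous f -> continuous g -> continuous (fun t => (f t, g t)).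
Proof. by move=> cf cg x; apply: cvg_pair; [exact: cf|exact: cg]. Qed.

Lemma continuous_circle (R : realType) (a b rho : R) :
  continuous (fun t => (a + rho * cos t, b + rho * sin t)).
Proof.
apply: continuous_pair => t; apply: cvgD; try exact: cvg_cst;
  apply: cvgM; try exact: cvg_cst.
- exact: continuous_cos.
- exact: continuous_sin.
Qed.

(** * Measurability of continuous functions for the product sigma-algebra of the plane *)

Section PlaneMeasurability.
Context {R : realType}.
Local Notation plane := (R * R)%type.
Local Notation mplane := (measurableTypeR R * measurableTypeR R)%type.

(** Every point of [U] lies in a box with rational centre and rational half-width contained in [U];
    hence [U] is a countable union of measurable rectangles. *)
Lemma open_measurable_plane (U : set plane) :
  open U -> measurable (U : set mplane).
Proof.
move=> oU.
pose box (q1 q2 e : rat) : set plane :=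
  [set` `](ratr q1 - ratr e : R), (ratr q1 + ratr e)[] `*`
  [set` `](ratr q2 - ratr e : R), (ratr q2 + ratr e)[].
(* Boxes that leave [U] are replaced by the empty set, so that the union can run over all rational
   triples. *)
pose F q1 q2 e : set mplane := if `[< box q1 q2 e `<=` U >] then box q1 q2 e else set0.
rewrite (_ : U = \bigcup_q1 \bigcup_q2 \bigcup_e F q1 q2 e).
  apply: bigcupT_measurable_rat => q1; apply: bigcupT_measurable_rat => q2.
  apply: bigcupT_measurable_rat => e; rewrite /F; case: asboolP => // _.
  by apply: measurableX; exact: measurable_itv.
apply/seteqP; split => [p Up|p [q1 _ [q2 _ [e _]]]]; last first.
  by rewrite /F; case: asboolP => // + ?; apply.
have /nbhs_ballP[e /= e0 pe] : nbhs p U by exact: open_nbhs_nbhs.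
have [d] : exists q : rat, ratr q \in `]0, (e / 2)[ by apply: rat_in_itvoo; rewrite divr_gt0.
rewrite in_itv/= => /andP[d0 de].
have [q1] : exists q : rat, ratr q \in `](p.1 - ratr d), (p.1 + ratr d)[.
  by apply: rat_in_itvoo; lra.
rewrite in_itv/= => /andP[q1l q1r].
have [q2] : exists q : rat, ratr q \in `](p.2 - ratr d), (p.2 + ratr d)[.
  by apply: rat_in_itvoo; lra.
rewrite in_itv/= => /andP[q2l q2r].
exists q1 => //; exists q2 => //; exists d => //.
rewrite /F; case: asboolP => [_|].
  by split => /=; rewrite in_itv/=; apply/andP; split; lra.
case=> /= z [] /=; rewrite !in_itv/= => /andP[z1l z1r] /andP[z2l z2r].
by apply: pe; split; rewrite /ball /= ltr_norml; apply/andP; split; lra.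
Qed.

Lemma continuous_measurable_plane (f : plane -> R) :
  continuous f -> measurable_fun setT (f : mplane -> R).
Proof.
move=> cf; apply: (measurability _ (RGenOInfty.measurableE R)).
move=> _ [_ [a ->] <-]; rewrite setTI.
apply: open_measurable_plane; apply: open_comp; last exact: interval_open.
by move=> x _; exact: cf.
Qed.

End PlaneMeasurability.

(** * Disks: measurability, finite measure, integrability of continuous functions *)

Section EuclideanDisk.
Context {R : realType}.
Local Notation plane := (R * R)%type.
Implicit Types (a b rho : R) (f : plane -> R).

(** A form without square roots, in real coordinates: openness is then immediate, and vertical
    sections are intervals. *)
Definition rdisk a b rho : set plane :=
  [set p | (p.1 - a) ^+ 2 + (p.2 - b) ^+ 2 < rho ^+ 2].

Lemma disk_rdisk a b rho : 0 < rho -> disk (a +i* b) rho = rdisk a b rho.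
Proof.
move=> rho0; have sqrtE x : (Num.sqrt x < rho) = (x < rho ^+ 2).
  by rewrite -[X in _ < X](gtr0_norm rho0) -sqrtr_sqr ltr_sqrt ?exprn_gt0.
by apply/seteqP; split => p; rewrite /disk /rdisk /= sqrtE.
Qed.

Lemma open_rdisk a b rho : open (rdisk a b rho).
Proof.
apply: (@open_comp _ _ (fun p : plane => (p.1 - a) ^+ 2 + (p.2 - b) ^+ 2)
  [set x | x < rho ^+ 2]); last exact: open_lt.
move=> p _; apply: cvgD; apply: cvgM; apply: cvgB; do ?exact: cvg_cst.
- exact: continuous_fst.
- exact: continuous_fst.
- exact: continuous_snd.
- exact: continuous_snd.
Qed.

Lemma measurable_rdisk a b rho :
  measurable (rdisk a b rho : set (measurableTypeR R * measurableTypeR R)).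
Proof. by apply: open_measurable_plane; exact: open_rdisk. Qed.

(** The box has finite measure and is compact; the first bounds the measure of the disk, the second
    bounds continuous functions on it. *)
Lemma rdisk_box a b rho : 0 < rho ->
  rdisk a b rho `<=` `[a - rho, a + rho] `*` `[b - rho, b + rho].
Proof.
move=> rho0 p; rewrite /rdisk /= => prho; rewrite !in_itv/= -!ler_distl.
by split; rewrite -(@ler_pXn2r _ 2)// ?nnegrE ?ltW// real_normK ?num_real//;
  apply: le_lt_trans prho; rewrite (lerDl, lerDr) sqr_ge0.
Qed.

Lemma plane_measure_rdisk_lty a b rho : 0 < rho ->
  (plane_measure (rdisk a b rho) < +oo)%E.
Proof.
move=> rho0.
pose I (x : R) : set (measurableTypeR R) := [set` `[x - rho, x + rho]].
apply: (@le_lt_trans _ _ (plane_measure (I a `*` I b))).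
  apply: le_measure; last exact: rdisk_box.
  - by rewrite inE; exact: measurable_rdisk.
  - by rewrite inE; apply: measurableX; exact: measurable_itv.
have -> : plane_measure (I a `*` I b) = (lebesgue_measure (I a) * lebesgue_measure (I b))%E.
  by apply: product_measure1E; exact: measurable_itv.
rewrite !lebesgue_measure_itv/= !lte_fin.
by do 2 case: ifP => _; rewrite ?mule0 ?mul0e// -?EFinD -?EFinM ltry.
Qed.

Lemma continuous_bounded_rdisk f a b rho : 0 < rho -> continuous f ->
  exists2 M, 0 < M & forall p, rdisk a b rho p -> `|f p| <= M.
Proof.
move=> rho0 cf.
have /compact_bounded[M [_ MB]] : compact (f @` (`[a - rho, a + rho] `*` `[b - rho, b + rho])).
  apply: continuous_compact; first exact: continuous_subspaceT.
  by apply: compact_setX; exact: segment_compact.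
exists (`|M| + 1) => [|p /(rdisk_box rho0) pB]; first by rewrite ltr_wpDl.
apply: MB; first by rewrite ltr_pwDr// ler_norm.
by exists p.
Qed.

Lemma continuous_integrable_rdisk f a b rho : 0 < rho -> continuous f ->
  plane_measure.-integrable (rdisk a b rho) (EFin \o f).
Proof.
move=> rho0 cf; apply: measurable_bounded_integrable.
- exact: measurable_rdisk.
- exact: plane_measure_rdisk_lty.
- by apply: measurable_funTS; exact: continuous_measurable_plane.
- have [M M0 MB] := continuous_bounded_rdisk a b rho0 cf.
  exists M; split; first exact: num_real.
  by move=> x Mx p /= /MB /le_trans; apply; exact: ltW.
Qed.

End EuclideanDisk.

(** * One-variable derivatives and the fundamental theorem of calculus *)

Section PartialDerivatives.
Context {R : realType}.
Local Notation plane := (R * R)%type.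
Implicit Types (F : plane -> R) (x y : R).

Lemma is_derive_snd F x y : derivable F (x, y) e2 ->
  is_derive y (1 : R) (fun y => F (x, y)) ('D_e2 F (x, y)).
Proof.
have E : (fun h : R => h^-1 *: (((fun y => F (x, y)) \o shift y) (h *: (1 : R)) - F (x, y))) =
         (fun h : R => h^-1 *: ((F \o shift (x, y)) (h *: e2) - F (x, y))).
  apply/funext => h /=; congr (_ *: (F _ - _)).
  by rewrite (_ : h *: e2 + (x, y) = (h *: 0 + x, h *: 1 + y))// scaler0 add0r.
by move=> dF; apply: DeriveDef; rewrite /derivable /derive E.
Qed.

End PartialDerivatives.

Section IntegralOnIntervals.
Context {R : realType}.
Local Notation mu := (@lebesgue_measure R).
Implicit Types (f F : R -> R) (a b : R).

Lemma is_derive_LRcontinuous F f a b : (forall x, is_derive x (1 : R) F (f x)) ->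
  derivable_oo_LRcontinuous F a b.
Proof.
move=> dF; have cF x : {for x, continuous F}.
  by apply: differentiable_continuous; apply/derivable1_diffP; case: (dF x).
split.
- by move=> x _; case: (dF x).
- by apply: cvg_at_right_filter; exact: cF.
- by apply: cvg_at_left_filter; exact: cF.
Qed.

Lemma is_derive_FTC f F a b : a <= b -> continuous f ->
  (forall x, is_derive x (1 : R) F (f x)) ->
  (\int[mu]_(x in `[a, b]) (f x)%:E = (F b - F a)%:E)%E.
Proof.
rewrite le_eqVlt => /predU1P[-> _ _|ab cf dF].
  by rewrite set_itv1 integral_set1 subrr.
rewrite (continuous_FTC2 ab _ (is_derive_LRcontinuous a b dF))//.
- exact: continuous_subspaceT.
- by move=> x _; rewrite derive1E; case: (dF x).
Qed.

Lemma is_derive_FTC_oo f F a b : a <= b -> continuous f ->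
  (forall x, is_derive x (1 : R) F (f x)) ->
  (\int[mu]_(x in `]a, b[) (f x)%:E = (F b - F a)%:E)%E.
Proof.
move=> ab cf dF; rewrite -(is_derive_FTC ab cf dF).
rewrite integral_itv_bndo_bndc ?integral_itv_obnd_cbnd//;
  by apply/measurable_EFinP; apply: measurable_funTS; exact: continuous_measurable_fun.
Qed.

End IntegralOnIntervals.

(** * Green's identity on a disk for real functions *)

Section GreenIdentity.
Context {R : realType}.
Local Notation plane := (R * R)%type.
Local Notation mu := (@lebesgue_measure R).
Implicit Types (F : plane -> R) (a b rho x y t : R).

(** Since [Num.sqrt] is 0 on negative numbers, this is 0 for vertical lines that miss the disk, and
    the identities on chords hold for every [x]. *)
Definition half_chord rho a x : R := Num.sqrt (rho ^+ 2 - (x - a) ^+ 2).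

Lemma continuous_half_chord rho a : continuous (half_chord rho a).
Proof.
move=> x; apply: (@continuous_comp _ _ _ (fun x => rho ^+ 2 - (x - a) ^+ 2) Num.sqrt);
  last exact: sqrt_continuous.
by apply: cvgB; [exact: cvg_cst|apply: cvgM; apply: cvgB => //; exact: cvg_cst].
Qed.

Lemma rdisk_half_chord a b rho x y :
  rdisk a b rho (x, y) <-> y \in `](b - half_chord rho a x), (b + half_chord rho a x)[.
Proof.
rewrite /rdisk/= in_itv/= -ltr_distl /half_chord -sqrtr_sqr -ltrBrDl.
have [w0|w0] := ltP 0 (rho ^+ 2 - (x - a) ^+ 2); first by rewrite ltr_sqrt.
rewrite (ler0_sqrtr w0).
by split => [/lt_le_trans/(_ w0)|]; rewrite ltNge ?sqr_ge0 ?sqrtr_ge0.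
Qed.

Lemma half_chord_out a rho x : 0 < rho -> x \notin `[a - rho, a + rho] ->
  half_chord rho a x = 0.
Proof.
rewrite in_itv/= -ler_distl -ltNge => rho0 rx; apply: ler0_sqrtr.
by rewrite subr_le0 -[leRHS]real_normK ?num_real// ler_pXn2r ?nnegrE// ltW.
Qed.

Lemma half_chord_cos rho a t : 0 <= rho -> half_chord rho a (a + rho * cos t) = rho * `|sin t|.
Proof.
move=> rho0; rewrite /half_chord addrAC subrr add0r.
rewrite (_ : _ - _ = (rho * sin t) ^+ 2); last by rewrite !exprMn sin2cos2; ring.
by rewrite sqrtr_sqr normrM ger0_norm.
Qed.

(** On the vertical chord, [F (x, _)] is a primitive of the integrand; when the line misses the
    disk, both sides are 0. *)
Lemma integral_chord F a b rho x : 
  continuous (fun p => 'D_e2 F p) -> (forall p, derivable F p e2) ->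
  (\int[mu]_y ((fun p => 'D_e2 F p) \_ (rdisk a b rho) (x, y))%:E =
   (F (x, b + half_chord rho a x) - F (x, b - half_chord rho a x))%:E)%E.
Proof.
move=> cDF dF; pose s := half_chord rho a x.
transitivity (\int[mu]_(y in `](b - s)%R, (b + s)%R[) ('D_e2 F (x, y))%:E)%E; last first.
  apply: (@is_derive_FTC_oo _ (fun y => 'D_e2 F (x, y)) (fun y => F (x, y))).
  - by rewrite lerD2l ge0_cp// sqrtr_ge0.
  - move=> y; apply: (@continuous_comp _ _ _ (fun y => (x, y)) (fun p => 'D_e2 F p));
      last exact: cDF.
    by apply: continuous_pair => ?; [exact: cvg_cst|exact: cvg_id].
  - by move=> y; exact: is_derive_snd.
rewrite [RHS]integral_mkcond; apply: eq_integral => y _.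
rewrite !patchE; have [rx|rx] := boolP (y \in _).
  by rewrite mem_set//; apply/rdisk_half_chord; rewrite inE in rx.
rewrite memNset//; apply: contraNnot rx => /rdisk_half_chord ?; exact/mem_set.
Qed.

Lemma is_derive_arc a rho t :
  is_derive t (1 : R) (fun t => a + rho * cos t) (- (rho * sin t)).
Proof. by apply: is_derive_eq; rewrite add0r mul1r scalerN. Qed.

(* The substitution x = a + rho cos t parametrizes the upper half circle on
   [0, pi] and the lower one on [pi, 2 pi]. *)
Lemma integral_cos_substitution_upper (G : R -> R) a rho : 0 < rho -> continuous G ->
  (\int[mu]_(x in `[(a - rho)%R, (a + rho)%R]) (G x)%:E =
   \int[mu]_(t in `[0%R, pi]) (G (a + rho * cos t) * (rho * sin t))%R%:E)%E.
Proof.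
move=> rho0 cG; pose f t := a + rho * cos t.
have df t : is_derive t (1 : R) f (- (rho * sin t)) := is_derive_arc a rho t.
have dfE : (f^`()%classic) = (fun t => - (rho * sin t)).
  by apply/funext => t; rewrite derive1E; case: (df t).
have cdf : continuous (f^`()%classic).
  rewrite dfE => t; apply: cvgN; apply: cvgM; [exact: cvg_cst|exact: continuous_sin].
have := @integration_by_substitution_decreasing R f G 0 pi (pi_ge0 R).
have -> : f 0 = a + rho by rewrite /f cos0 mulr1.
have -> : f pi = a - rho by rewrite /f cospi mulrN1.
move=> ->.
- by apply: eq_integral => t _; rewrite !fctE dfE opprK.
- move=> s t s0 t0 st; rewrite ltrD2l ltr_pM2l// ltr_cos//.
- by move=> t _; exact: cdf.
- by apply: cvgP; apply: cvg_at_right_filter; exact: cdf.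
- by apply: cvgP; apply: cvg_at_left_filter; exact: cdf.
- exact: is_derive_LRcontinuous df.
- exact: continuous_subspaceT.
Qed.

Lemma integral_cos_substitution_lower (G : R -> R) a rho : 0 < rho -> continuous G ->
  (\int[mu]_(x in `[(a - rho)%R, (a + rho)%R]) (G x)%:E =
   \int[mu]_(t in `[pi, (2 * pi)%R]) (G (a + rho * cos t) * - (rho * sin t))%R%:E)%E.
Proof.
move=> rho0 cG; pose f t := a + rho * cos t.
have df t : is_derive t (1 : R) f (- (rho * sin t)) := is_derive_arc a rho t.
have dfE : (f^`()%classic) = (fun t => - (rho * sin t)).
  by apply/funext => t; rewrite derive1E; case: (df t).
have cdf : continuous (f^`()%classic).
  rewrite dfE => t; apply: cvgN; apply: cvgM; [exact: cvg_cst|exact: continuous_sin].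
have pi2 : pi <= 2 * pi :> R by have := pi_ge0 R; lra.
have := @integration_by_substitution_increasing R f G pi (2 * pi) pi2.
have -> : f pi = a - rho by rewrite /f cospi mulrN1.
have -> : f (2 * pi) = a + rho by rewrite /f [2 * pi]mulr_natl cos2pi mulr1.
move=> ->.
- by apply: eq_integral => t _; rewrite !fctE dfE.
- move=> s t; rewrite !in_itv/= => /andP[s0 s1] /andP[t0 t1] st.
  rewrite ltrD2l ltr_pM2l//.
  (* The cosine increases on [[pi, 2 * pi]] because cos s = cos (2 pi - s) and it decreases on
     [[0, pi]]. *)
  rewrite -(cosN s) -(cosN t) -(cosD2pi (- s)) -(cosD2pi (- t)).
  by rewrite ltr_cos ?in_itv/=; [|apply/andP; split|apply/andP; split]; lra.
- by move=> t _; exact: cdf.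
- by apply: cvgP; apply: cvg_at_right_filter; exact: cdf.
- by apply: cvgP; apply: cvg_at_left_filter; exact: cdf.
- exact: is_derive_LRcontinuous df.
- exact: continuous_subspaceT.
Qed.


Lemma integral_itv_split (f : R -> R) a b c : a <= b -> b <= c -> continuous f ->
  (\int[mu]_(t in `[a, b]) (f t)%:E + \int[mu]_(t in `[b, c]) (f t)%:E =
   \int[mu]_(t in `[a, c]) (f t)%:E)%E.
Proof.
move=> ab bc cf; have mf A : measurable_fun A (EFin \o f).
  by apply/measurable_EFinP; apply: measurable_funTS; exact: continuous_measurable_fun.
rewrite -(@integral_itv_obnd_cbnd _ b (BRight c))// -integral_setU//=.
- by rewrite (@itv_bndbnd_setU _ _ (BLeft a) (BRight b) (BRight c)).
- exact: mf.
- apply/disj_setPS => t [/=]; rewrite !in_itv/= => /andP[_ tb] /andP[].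
  by rewrite ltNge tb.
Qed.

(** The reflection maps the period onto [[- 3 pi / 2, pi / 2]]; its negative part is brought back by
    periodicity. *)
Lemma integral_angles_rotate (h : R -> R) : continuous h -> periodic h (2 * pi) ->
  (\int[mu]_(t in angles) (h (pi / 2 - t))%:E = \int[mu]_(t in angles) (h t)%:E)%E.
Proof.
move=> ch ph; have pi0 := pi_gt0 R.
pose f (t : R) := pi / 2 - t; pose g (t : R) := t - 2 * pi.
have df t : is_derive t (1 : R) f (- 1).
  by rewrite /f; apply: is_derive_eq; ring.
have dg t : is_derive t (1 : R) g 1.
  by rewrite /g; apply: is_derive_eq; ring.
have dfE : f^`()%classic = cst (- 1).
  by apply/funext => t; rewrite derive1E; case: (df t).
have dgE : g^`()%classic = cst 1.
  by apply/funext => t; rewrite derive1E; case: (dg t).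
have -> : (\int[mu]_(t in angles) (h (pi / 2 - t))%:E =
           \int[mu]_(t in `[f (2 * pi)%R, f 0%R]) (h t)%:E)%E.
  rewrite (@integration_by_substitution_decreasing R f h 0 (2 * pi)).
  - by apply: eq_integral => t _; rewrite !fctE dfE /= opprK mulr1.
  - lra.
  - by move=> s t _ _; rewrite /f => ?; lra.
  - by rewrite dfE => t _; exact: cvg_cst.
  - by rewrite dfE; exact: is_cvg_cst.
  - by rewrite dfE; exact: is_cvg_cst.
  - exact: is_derive_LRcontinuous df.
  - exact: continuous_subspaceT.
have -> : f 0 = pi / 2 by rewrite /f subr0.
have -> : f (2 * pi) = g (pi / 2) by rewrite /f /g.
(* Split at [0 = g (2 * pi)]: the shift [g] maps [[pi / 2, 2 * pi]] onto the negative part. *)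
rewrite -(@integral_itv_split h (g (pi / 2)) (g (2 * pi)) (pi / 2))//; last 2 first.
- by rewrite /g; lra.
- by rewrite /g; lra.
rewrite (@integration_by_substitution_increasing R g h (pi / 2) (2 * pi)).
- have -> : g (2 * pi) = 0 by rewrite /g subrr.
  rewrite /angles -(@integral_itv_split h 0 (pi / 2) (2 * pi))//; [|lra|lra].
  rewrite addeC; congr (_ + _)%E; apply: eq_integral => t _.
  by rewrite !fctE dgE /= mulr1 -[t in RHS](subrK (2 * pi)) ph.
- lra.
- by move=> s t _ _; rewrite /g => ?; lra.
- by rewrite dgE => t _; exact: cvg_cst.
- by rewrite dgE; exact: is_cvg_cst.
- by rewrite dgE; exact: is_cvg_cst.
- exact: is_derive_LRcontinuous dg.
- exact: continuous_subspaceT.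
Qed.

(** Each chord contributes the value of [F] at its upper end minus the value at its lower end. After
    the substitution the upper ends fill t in [[0, pi]]. On [[pi, 2 * pi]] one has |sin t| = - sin
    t, so the lower end is again at height [b + rho * sin t], and the minus sign of the difference
    cancels the one of the substitution. *)
Lemma iterated_integral_rdisk F a b rho : 0 < rho -> continuous F ->
  continuous (fun p => 'D_e2 F p) -> (forall p, derivable F p e2) ->
  (\int[mu]_x \int[mu]_y ((fun p => 'D_e2 F p) \_ (rdisk a b rho) (x, y))%:E =
   \int[mu]_(t in angles) (F (a + rho * cos t, b + rho * sin t) * (rho * sin t))%R%:E)%E.
Proof.
move=> rho0 cF cDF dF; pose h := half_chord rho a.
pose Gu x := F (x, b + h x); pose Gl x := F (x, b - h x).
have ch : continuous h by exact: continuous_half_chord.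
have cGu : continuous Gu.
  move=> x; apply: (@continuous_comp _ _ _ (fun x => (x, b + h x)) F); last exact: cF.
  apply: continuous_pair => z; first exact: cvg_id.
  by apply: cvgD; [exact: cvg_cst|exact: ch].
have cGl : continuous Gl.
  move=> x; apply: (@continuous_comp _ _ _ (fun x => (x, b - h x)) F); last exact: cF.
  apply: continuous_pair => z; first exact: cvg_id.
  by apply: cvgB; [exact: cvg_cst|exact: ch].
have cI (G : R -> R) (A : set R) : continuous G -> compact A -> mu.-integrable A (EFin \o G).
  by move=> cG cA; apply: continuous_compact_integrable => //; exact: continuous_subspaceT.
transitivity (\int[mu]_(x in `[(a - rho)%R, (a + rho)%R]) ((Gu x)%:E - (Gl x)%:E))%E.
  rewrite [RHS]integral_mkcond; apply: eq_integral => x _.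
  rewrite integral_chord// patchE; case: ifPn => // xI.
  by rewrite half_chord_out ?addr0 ?subr0 ?subrr//; apply: contra xI => ?; rewrite inE.
rewrite integralB//; [|exact: (cI _ _ cGu (@segment_compact _ _ _))|exact: (cI _ _ cGl (@segment_compact _ _ _))].
rewrite integral_cos_substitution_upper// integral_cos_substitution_lower//.
set f := fun t => (F (a + rho * cos t, b + rho * sin t) * (rho * sin t))%R.
have cf : continuous f.
  move=> t; apply: cvgM.
    apply: (@continuous_comp _ _ _ (fun t => (a + rho * cos t, b + rho * sin t)) F); last exact: cF.
    exact: continuous_circle.
  by apply: cvgM; [exact: cvg_cst|exact: continuous_sin].
have pi0 := pi_gt0 R.
rewrite /angles -(@integral_itv_split f 0 pi (2 * pi))//; [|lra|lra].
congr (_ + _)%E.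
  apply: eq_integral => t; rewrite inE/= in_itv/= => tpi.
  by rewrite /Gu /h half_chord_cos ?ltW// ger0_norm// sin_ge0_pi.
have hI : mu.-integrable [set` `[pi, (2 * pi)%R]]
    (EFin \o (fun t => Gl (a + rho * cos t) * - (rho * sin t))).
  apply: cI; last exact: segment_compact.
  move=> t; apply: cvgM; last first.
    by apply: cvgN; apply: cvgM; [exact: cvg_cst|exact: continuous_sin].
  apply: (@continuous_comp _ _ _ (fun t => a + rho * cos t) Gl); last exact: cGl.
  by apply: cvgD; [exact: cvg_cst|apply: cvgM; [exact: cvg_cst|exact: continuous_cos]].
rewrite -integralN; last exact: integrable_add_def hI.
apply: eq_integral => t; rewrite inE/= in_itv/= => /andP[tpi t2pi].
have sin_le0 : sin t <= 0.
  by rewrite -[t](subrK pi) sinDpi oppr_le0 sin_ge0_pi//; apply/andP; split; lra.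
rewrite mulrN opprK /f /Gl /h half_chord_cos ?ltW// ler0_norm//.
by rewrite mulrN opprK.
Qed.

Lemma integrable_rdisk_restrict F a b rho : 0 < rho -> continuous F ->
  plane_measure.-integrable setT (fun z => ((F \_ (rdisk a b rho)) z)%:E).
Proof.
move=> rho0 cF.
rewrite (_ : (fun z => _) = (EFin \o F) \_ (rdisk a b rho)); last by rewrite restrict_EFin.
apply/integrable_restrict => //; first exact: measurable_rdisk.
by rewrite setTI; exact: continuous_integrable_rdisk.
Qed.

(** The divergence theorem for the field (0, F): [rho * sin t] is the second component of the
    outward normal times the density of arc length. *)
Lemma Rintegral_rdisk_e2 F a b rho : 0 < rho -> continuous F ->
  continuous (fun p => 'D_e2 F p) -> (forall p, derivable F p e2) ->
  \int[plane_measure]_(p in rdisk a b rho) 'D_e2 F p =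
  \int[mu]_(t in angles) (F (a + rho * cos t, b + rho * sin t) * (rho * sin t)).
Proof.
move=> rho0 cF cDF dF; rewrite [RHS]/Rintegral -iterated_integral_rdisk//.
rewrite Rintegral_mkcond; congr fine.
rewrite -(@integral12_prod_meas1 _ _ _ _ _ mu mu
  (fun z => (((fun p => 'D_e2 F p) \_ (rdisk a b rho)) z)%:E))//.
exact: integrable_rdisk_restrict.
Qed.

(** Exchanging the coordinates reduces this to vertical chords and to the other order of
    integration. The exchange replaces the angle t by pi / 2 - t, which [integral_angles_rotate]
    undoes. *)
Lemma Rintegral_rdisk_e1 F a b rho : 0 < rho -> continuous F ->
  continuous (fun p => 'D_e1 F p) -> (forall p, derivable F p e1) ->
  \int[plane_measure]_(p in rdisk a b rho) 'D_e1 F p =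
  \int[mu]_(t in angles) (F (a + rho * cos t, b + rho * sin t) * (rho * cos t)).
Proof.
move=> rho0 cF cDF dF; pose F' (q : plane) := F (q.2, q.1).
have dF' q : is_derive q e2 F' ('D_e1 F (q.2, q.1)).
  have E : (fun h : R => h^-1 *: ((F' \o shift q) (h *: e2) - F' q)) =
           (fun h : R => h^-1 *: ((F \o shift (q.2, q.1)) (h *: e1) - F (q.2, q.1))).
    by apply/funext => h /=; congr (_ *: (F _ - _)).
  by apply: DeriveDef; [have := dF (q.2, q.1)|]; rewrite /derivable /derive E.
have DF' : (fun q => 'D_e2 F' q) = (fun q => 'D_e1 F (q.2, q.1)).
  by apply/funext => q; case: (dF' q).
have cswap : continuous (fun q : plane => (q.2, q.1)).
  by apply: continuous_pair; [exact: continuous_snd|exact: continuous_fst].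
have cF' : continuous F'.
  by move=> q; apply: (@continuous_comp _ _ _ (fun q : plane => (q.2, q.1)) F); [exact: cswap|exact: cF].
have := @iterated_integral_rdisk F' b a rho rho0 cF'.
rewrite DF' => /(_ _ _)/wrap[].
- by move=> q; apply: (@continuous_comp _ _ _ (fun q : plane => (q.2, q.1)) (fun p => 'D_e1 F p));
    [exact: cswap|exact: cDF].
- by move=> q; case: (dF' q).
pose h t := F (a + rho * cos t, b + rho * sin t) * (rho * cos t).
have ch : continuous h.
  move=> t; apply: cvgM.
    apply: (@continuous_comp _ _ _ (fun t => (a + rho * cos t, b + rho * sin t)) F); last exact: cF.
    exact: continuous_circle.
  by apply: cvgM; [exact: cvg_cst|exact: continuous_cos].
have hE t : h (pi / 2 - t) = F' (b + rho * cos t, a + rho * sin t) * (rho * sin t).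
  by rewrite /h /F' /= -cosN -[sin (_ - _)]opprK -sinN opprB sinBpihalf cosBpihalf opprK.
under [in X in _ = X -> _]eq_integral do rewrite -hE.
rewrite integral_angles_rotate//; last first.
  by move=> t; rewrite /h [2 * pi]mulr_natl cosD2pi sinD2pi.
move=> E; rewrite [RHS]/Rintegral -E Rintegral_mkcond; congr fine.
rewrite -(@integral21_prod_meas1 _ _ _ _ _ mu mu
  (fun z => (((fun p => 'D_e1 F p) \_ (rdisk a b rho)) z)%:E))//; last first.
  exact: integrable_rdisk_restrict.
apply: eq_integral => y _; apply: eq_integral => x _.
rewrite !patchE /=; have [rx|rx] := pselect (rdisk a b rho (x, y)).
  by rewrite !mem_set//; move: rx; rewrite /rdisk /= addrC.
by rewrite !memNset//; move: rx; rewrite /rdisk /= addrC.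
Qed.

End GreenIdentity.

(** * Complex-valued functions through their real and imaginary parts *)

Section ComplexParts.
Context {R : realType}.
Implicit Types x y : R[i].

Lemma complex_eqP x y : complex.Re x = complex.Re y -> complex.Im x = complex.Im y -> x = y.
Proof. by case: x y => [a b] [c d] /= -> ->. Qed.

Lemma Re_mul x y : complex.Re (x * y) =
  complex.Re x * complex.Re y - complex.Im x * complex.Im y.
Proof. by case: x y => [a b] [c d]. Qed.

Lemma Im_mul x y : complex.Im (x * y) =
  complex.Re x * complex.Im y + complex.Im x * complex.Re y.
Proof. by case: x y => [a b] [c d]. Qed.

Lemma Re_add x y : complex.Re (x + y) = complex.Re x + complex.Re y.
Proof. by case: x y => [a b] [c d]. Qed.

Lemma Im_add x y : complex.Im (x + y) = complex.Im x + complex.Im y.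
Proof. by case: x y => [a b] [c d]. Qed.

Lemma Re_opp x : complex.Re (- x) = - complex.Re x.
Proof. by case: x. Qed.

Lemma Im_opp x : complex.Im (- x) = - complex.Im x.
Proof. by case: x. Qed.

Lemma Re_cconj x : complex.Re x^* = complex.Re x.
Proof. by case: x. Qed.

Lemma Im_cconj x : complex.Im x^* = - complex.Im x.
Proof. by case: x. Qed.

Definition ReImE := (Re_mul, Im_mul, Re_add, Im_add, Re_opp, Im_opp, Re_cconj, Im_cconj).

Lemma normc_sqr x : normc x ^+ 2 = complex.Re x ^+ 2 + complex.Im x ^+ 2.
Proof. by case: x => a b /=; rewrite sqr_sqrtr// addr_ge0 ?sqr_ge0. Qed.

Lemma normc_ge0 x : 0 <= normc x.
Proof. by case: x => a b; exact: sqrtr_ge0. Qed.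

Lemma normc_conj x : normc x^* = normc x.
Proof. by case: x => a b /=; rewrite sqrrN. Qed.

Lemma Re_le_normc x : `|complex.Re x| <= normc x.
Proof.
by case: x => a b /=; rewrite -[leLHS]sqrtr_sqr ler_wsqrtr// lerDl sqr_ge0.
Qed.

Lemma Im_le_normc x : `|complex.Im x| <= normc x.
Proof.
by case: x => a b /=; rewrite -[leLHS]sqrtr_sqr ler_wsqrtr// lerDr sqr_ge0.
Qed.

End ComplexParts.

Section ComplexContinuity.
Context {R : realType} {T : topologicalType}.
Implicit Types f g : T -> R[i].

Definition ccontinuous f :=
  continuous (fun p => complex.Re (f p)) /\ continuous (fun p => complex.Im (f p)).

Lemma ccontinuousM f g : ccontinuous f -> ccontinuous g -> ccontinuous (fun p => f p * g p).
Proof.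
move=> [f1 f2] [g1 g2]; split.
  under eq_fun do rewrite Re_mul; move=> p; apply: cvgB; apply: cvgM;
  [exact: f1|exact: g1|exact: f2|exact: g2].
under eq_fun do rewrite Im_mul; move=> p; apply: cvgD; apply: cvgM;
[exact: f1|exact: g2|exact: f2|exact: g1].
Qed.

Lemma ccontinuous_cst (c : R[i]) : ccontinuous (fun _ : T => c).
Proof. by split => p; exact: cvg_cst. Qed.

Lemma ccontinuous_real (h : T -> R) : continuous h -> ccontinuous (fun p => (h p)%:C).
Proof. by move=> ch; split => //= p; exact: cvg_cst. Qed.

End ComplexContinuity.

Lemma ccontinuous_comp (R : realType) (S T : topologicalType) (g : S -> T) (f : T -> R[i]) :
  continuous g -> ccontinuous f -> ccontinuous (fun s => f (g s)).
Proof.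
move=> cg [f1 f2]; split => s.
  by apply: (@continuous_comp _ _ _ g (fun p => complex.Re (f p))); [exact: cg|exact: f1].
by apply: (@continuous_comp _ _ _ g (fun p => complex.Im (f p))); [exact: cg|exact: f2].
Qed.

Section ComplexIntegral.
Context d (T : measurableType d) (R : realType).
Variables (mu : {measure set T -> \bar R}) (D : set T).
Hypothesis mD : measurable D.
Implicit Types f g : T -> R[i].

Definition cintegrable f :=
  mu.-integrable D (EFin \o (fun x => complex.Re (f x))) /\
  mu.-integrable D (EFin \o (fun x => complex.Im (f x))).

Lemma eq_cintegral f g : (forall x, D x -> f x = g x) -> cintegral mu D f = cintegral mu D g.
Proof.
by move=> fg; apply: complex_eqP => /=; apply: eq_Rintegral => x /set_mem Dx; rewrite fg.
Qed.

Lemma cintegrableD f g : cintegrable f -> cintegrable g -> cintegrable (fun x => f x + g x).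
Proof.
move=> [f1 f2] [g1 g2]; split.
  rewrite (_ : _ \o _ = (EFin \o (fun x => complex.Re (f x))) \+ (EFin \o (fun x => complex.Re (g x)))).
    exact: integrableD.
  by apply/funext => x /=; rewrite Re_add.
rewrite (_ : _ \o _ = (EFin \o (fun x => complex.Im (f x))) \+ (EFin \o (fun x => complex.Im (g x)))).
  exact: integrableD.
by apply/funext => x /=; rewrite Im_add.
Qed.

Lemma cintegralD f g : cintegrable f -> cintegrable g ->
  cintegral mu D (fun x => f x + g x) = cintegral mu D f + cintegral mu D g.
Proof.
move=> [f1 f2] [g1 g2]; apply: complex_eqP => /=.
  by rewrite -RintegralD//; apply: eq_Rintegral => x _; rewrite Re_add.
by rewrite -RintegralD//; apply: eq_Rintegral => x _; rewrite Im_add.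
Qed.

Lemma integrable_Zl (a : R) (h : T -> R) : mu.-integrable D (EFin \o h) ->
  mu.-integrable D (EFin \o (fun x => a * h x)).
Proof. by move=> ih; apply: (integrableZl mD a ih). Qed.

Lemma integrable_lin (a b : R) (h k : T -> R) : mu.-integrable D (EFin \o h) ->
  mu.-integrable D (EFin \o k) -> mu.-integrable D (EFin \o (fun x => a * h x + b * k x)).
Proof.
by move=> ih ik; exact: (integrableD mD (integrable_Zl a ih) (integrable_Zl b ik)).
Qed.

Lemma Rintegral_lin (a b : R) (h k : T -> R) : mu.-integrable D (EFin \o h) ->
  mu.-integrable D (EFin \o k) -> \int[mu]_(x in D) (a * h x + b * k x) =
  a * \int[mu]_(x in D) h x + b * \int[mu]_(x in D) k x.
Proof.
by move=> ih ik; rewrite RintegralD ?RintegralZl//; exact: integrable_Zl.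
Qed.

Lemma cintegrableZ (c : R[i]) f : cintegrable f -> cintegrable (fun x => c * f x).
Proof.
case: c => a b [f1 f2]; split.
  rewrite (_ : _ \o _ = EFin \o (fun x => a * complex.Re (f x) + (- b) * complex.Im (f x))).
    exact: integrable_lin.
  by apply/funext => x /=; rewrite Re_mul /= mulNr.
rewrite (_ : _ \o _ = EFin \o (fun x => a * complex.Im (f x) + b * complex.Re (f x))).
  exact: integrable_lin.
by apply/funext => x /=; rewrite Im_mul /=.
Qed.

Lemma cintegralZ (c : R[i]) f : cintegrable f ->
  cintegral mu D (fun x => c * f x) = c * cintegral mu D f.
Proof.
case: c => a b [f1 f2]; apply: complex_eqP; rewrite !(Re_mul, Im_mul) /=.
  rewrite -mulNr -Rintegral_lin//; apply: eq_Rintegral => x _.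
  by rewrite Re_mul mulNr.
by rewrite -Rintegral_lin//; apply: eq_Rintegral => x _; rewrite Im_mul.
Qed.

Lemma cintegral_conj f : cintegrable f ->
  cintegral mu D (fun x => (f x)^*) = (cintegral mu D f)^*.
Proof.
move=> [f1 f2]; apply: complex_eqP; rewrite ?(Re_cconj, Im_cconj) /=.
  by apply: eq_Rintegral => x _; rewrite Re_cconj.
by rewrite -mulN1r -RintegralZl//; apply: eq_Rintegral => x _; rewrite Im_cconj mulN1r.
Qed.

Lemma cintegral0 : cintegral mu D (fun=> 0) = 0.
Proof. by apply: complex_eqP => /=; rewrite Rintegral_cst// mul0r. Qed.

Lemma cintegrable0 : cintegrable (fun=> 0).
Proof. by split; exact: integrable0. Qed.

Lemma cintegrable_sum (I : Type) (s : seq I) (F : I -> T -> R[i]) :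
  (forall i, cintegrable (F i)) -> cintegrable (fun x => \sum_(i <- s) F i x).
Proof.
move=> iF; elim: s => [|i s ih].
  by under eq_fun do rewrite big_nil; exact: cintegrable0.
by under eq_fun do rewrite big_cons; exact: cintegrableD.
Qed.

Lemma cintegral_sum (I : Type) (s : seq I) (F : I -> T -> R[i]) :
  (forall i, cintegrable (F i)) ->
  cintegral mu D (fun x => \sum_(i <- s) F i x) = \sum_(i <- s) cintegral mu D (F i).
Proof.
move=> iF; elim: s => [|i s ih].
  by under eq_fun do rewrite big_nil; rewrite cintegral0 big_nil.
rewrite big_cons -ih -cintegralD//; last exact: cintegrable_sum.
by apply: eq_cintegral => x _; rewrite big_cons.
Qed.

End ComplexIntegral.

(** * Smooth functions on the plane and their partial derivatives *)

Section Smoothness.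
Context {R : realType}.
Local Notation plane := (R * R)%type.
Implicit Types (u v : plane -> R).

Lemma smooth_continuous u : smooth u -> continuous u.
Proof. by move=> su; exact: su 0%N. Qed.

Lemma smooth_derivable1 u p : smooth u -> derivable u p e1.
Proof. by move=> su; case: (su 1%N). Qed.

Lemma smooth_derivable2 u p : smooth u -> derivable u p e2.
Proof. by move=> su; case: (su 1%N). Qed.

Lemma smooth_D1 u : smooth u -> smooth (fun p => 'D_e1 u p).
Proof. by move=> su k; case: (su k.+1). Qed.

Lemma smooth_D2 u : smooth u -> smooth (fun p => 'D_e2 u p).
Proof. by move=> su k; case: (su k.+1). Qed.

Lemma smooth_cst (c : R) : smooth (fun _ : plane => c).
Proof.
move=> k; elim: k c => [|k ih] c /=; first by move=> p; exact: cvg_cst.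
have E e : (fun p : plane => 'D_e (fun _ : plane => c) p) = (fun=> 0).
  by apply/funext => p; exact: derive_cst.
by split; rewrite ?E//; move=> p; exact: derivable_cst.
Qed.

Lemma Ck_add k u v : Ck k u -> Ck k v -> Ck k (fun p => u p + v p).
Proof.
elim: k u v => [|k ih] u v; first by move=> /= cu cv p; apply: cvgD; [exact: cu|exact: cv].
move=> [u1 u2 cu1 cu2] [v1 v2 cv1 cv2]; split.
- by move=> p; exact: derivableD.
- by move=> p; exact: derivableD.
- rewrite (_ : (fun p => _) = (fun p => 'D_e1 u p + 'D_e1 v p)); first exact: ih.
  by apply/funext => p; exact: deriveD.
- rewrite (_ : (fun p => _) = (fun p => 'D_e2 u p + 'D_e2 v p)); first exact: ih.
  by apply/funext => p; exact: deriveD.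
Qed.

Lemma smoothD u v : smooth u -> smooth v -> smooth (fun p => u p + v p).
Proof. by move=> su sv k; exact: Ck_add. Qed.

Lemma derive_mul u v p e : derivable u p e -> derivable v p e ->
  'D_e (fun q => u q * v q) p = 'D_e u p * v p + u p * 'D_e v p.
Proof.
by move=> du dv; rewrite (deriveM du dv) addrC [v p *: _]mulrC.
Qed.

(** Keeping full smoothness of both factors in the induction on [k] avoids comparing the classes
    [Ck] of different orders, which the product rule would mix. *)
Lemma smoothM u v : smooth u -> smooth v -> smooth (fun p => u p * v p).
Proof.
move=> su sv k; elim: k u v su sv => [|k ih] u v su sv.
  by move=> p; apply: cvgM; exact: smooth_continuous.
have du1 p := @smooth_derivable1 u p su; have du2 p := @smooth_derivable2 u p su.
have dv1 p := @smooth_derivable1 v p sv; have dv2 p := @smooth_derivable2 v p sv.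
split.
- by move=> p; exact: derivableM.
- by move=> p; exact: derivableM.
- under eq_fun do rewrite derive_mul//.
  by apply: Ck_add; apply: ih => //; exact: smooth_D1.
- under eq_fun do rewrite derive_mul//.
  by apply: Ck_add; apply: ih => //; exact: smooth_D2.
Qed.

Lemma smoothN u : smooth u -> smooth (fun p => - u p).
Proof.
move=> su; rewrite (_ : (fun p => _) = (fun p => (- 1) * u p)).
  by apply: smoothM => //; exact: smooth_cst.
by apply/funext => p; rewrite mulN1r.
Qed.

(** Every difference quotient with nonzero increment is equal to [f e]. *)
Lemma is_derive_linear (f : plane -> R) (p e : plane) :
  (forall h : R, f (h *: e + p) = h * f e + f p) -> is_derive p e f (f e).
Proof.
move=> lf; suff H : (fun h : R => h^-1 *: ((f \o shift p) (h *: e) - f p)) @ 0^' --> f e.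
  by apply: DeriveDef; [apply/cvg_ex; exists (f e)|apply: cvg_lim].
apply: (@cvg_trans _ (cst (f e) @ 0^')); last exact: cvg_cst.
apply: near_eq_cvg; near=> h; rewrite /= lf addrK.
have h0 : h != 0 by near: h; exact: nbhs_dnbhs_neq.
by rewrite [h^-1 *: _]mulrA mulVf// mul1r.
Unshelve. all: by end_near. Qed.

Lemma is_derive_fst_coord (p e : plane) : is_derive p e (fun q : plane => q.1) e.1.
Proof. exact: (@is_derive_linear (fun q : plane => q.1)). Qed.

Lemma is_derive_snd_coord (p e : plane) : is_derive p e (fun q : plane => q.2) e.2.
Proof. exact: (@is_derive_linear (fun q : plane => q.2)). Qed.

Lemma smooth_fst : smooth (fun p : plane => p.1).
Proof.
case=> [|k]; first exact: continuous_fst.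
have E e : (fun p : plane => 'D_e (fun q : plane => q.1) p) = (fun=> e.1).
  by apply/funext => p; case: (is_derive_fst_coord p e).
split; rewrite ?E; try exact: smooth_cst.
  by move=> p; case: (is_derive_fst_coord p e1).
by move=> p; case: (is_derive_fst_coord p e2).
Qed.

Lemma smooth_snd : smooth (fun p : plane => p.2).
Proof.
case=> [|k]; first exact: continuous_snd.
have E e : (fun p : plane => 'D_e (fun q : plane => q.2) p) = (fun=> e.2).
  by apply/funext => p; case: (is_derive_snd_coord p e).
split; rewrite ?E; try exact: smooth_cst.
  by move=> p; case: (is_derive_snd_coord p e1).
by move=> p; case: (is_derive_snd_coord p e2).
Qed.

End Smoothness.

Section ComplexSmoothness.
Context {R : realType}.
Local Notation plane := (R * R)%type.
Implicit Types (u v : plane -> R[i]).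

Lemma csmoothM u v : csmooth u -> csmooth v -> csmooth (fun p => u p * v p).
Proof.
move=> [u1 u2] [v1 v2]; split.
  under eq_fun do rewrite Re_mul.
  by apply: smoothD; [exact: smoothM|apply: smoothN; exact: smoothM].
under eq_fun do rewrite Im_mul.
by apply: smoothD; exact: smoothM.
Qed.

Lemma csmooth_conj u : csmooth u -> csmooth (fun p => (u p)^*).
Proof.
move=> [u1 u2]; split; first by under eq_fun do rewrite Re_cconj.
by under eq_fun do rewrite Im_cconj; exact: smoothN.
Qed.

Lemma csmooth_cst (c : R[i]) : csmooth (fun _ : plane => c).
Proof. by split; exact: smooth_cst. Qed.

Lemma csmoothX u n : csmooth u -> csmooth (fun p => u p ^+ n).
Proof.
move=> su; elim: n => [|n ih]; first exact: csmooth_cst.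
by under eq_fun do rewrite exprS; exact: csmoothM.
Qed.

Lemma csmooth_real (h : plane -> R) : smooth h -> csmooth (fun p => (h p)%:C).
Proof. by move=> sh; split => //; exact: smooth_cst. Qed.

Lemma csmooth_ccontinuous u : csmooth u -> ccontinuous u.
Proof. by move=> [u1 u2]; split; exact: smooth_continuous. Qed.

Lemma csmooth_cpartial1 u : csmooth u -> csmooth (cpartial e1 u).
Proof. by move=> [u1 u2]; split; exact: smooth_D1. Qed.

Lemma csmooth_cpartial2 u : csmooth u -> csmooth (cpartial e2 u).
Proof. by move=> [u1 u2]; split; exact: smooth_D2. Qed.

Definition cderivable u p e := derivable (fun q => complex.Re (u q)) p e /\
  derivable (fun q => complex.Im (u q)) p e.

Lemma csmooth_cderivable1 u p : csmooth u -> cderivable u p e1.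
Proof. by move=> [u1 u2]; split; exact: smooth_derivable1. Qed.

Lemma csmooth_cderivable2 u p : csmooth u -> cderivable u p e2.
Proof. by move=> [u1 u2]; split; exact: smooth_derivable2. Qed.

Lemma cpartialM u v p e : cderivable u p e -> cderivable v p e ->
  cpartial e (fun q => u q * v q) p = cpartial e u p * v p + u p * cpartial e v p.
Proof.
move=> [u1 u2] [v1 v2]; apply: complex_eqP; rewrite !ReImE /cpartial /=.
  under eq_fun do rewrite Re_mul.
  rewrite (deriveB (derivableM u1 v1) (derivableM u2 v2)).
  rewrite (derive_mul u1 v1) (derive_mul u2 v2); ring.
under eq_fun do rewrite Im_mul.
rewrite (deriveD (derivableM u1 v2) (derivableM u2 v1)).
rewrite (derive_mul u1 v2) (derive_mul u2 v1); ring.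
Qed.

Lemma cpartial_conj u p e : cderivable u p e ->
  cpartial e (fun q => (u q)^*) p = (cpartial e u p)^*.
Proof.
move=> [u1 u2]; apply: complex_eqP; rewrite !ReImE /cpartial /=.
  by under eq_fun do rewrite Re_cconj.
by under eq_fun do rewrite Im_cconj; exact: deriveN.
Qed.

Lemma cpartial_real (h : plane -> R) p e : cpartial e (fun q => (h q)%:C) p = ('D_e h p)%:C.
Proof. by apply: complex_eqP => //=; exact: derive_cst. Qed.

Lemma cpartial_cst (c : R[i]) (p e : plane) : cpartial e (fun=> c) p = 0.
Proof. by apply: complex_eqP; exact: derive_cst. Qed.

(** The first hypothesis holds for [e1] and for [e2]; assuming it lets one induction serve both
    directions. *)
Lemma cpartialX u n p e :
  (forall w q, csmooth w -> cderivable w q e) -> csmooth u ->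
  cpartial e (fun q => u q ^+ n.+1) p = n.+1%:R * u p ^+ n * cpartial e u p.
Proof.
move=> ds su; elim: n => [|n ih].
  by under eq_fun do rewrite expr1; rewrite expr0 !mul1r.
under eq_fun do rewrite exprS.
rewrite cpartialM; [|exact: ds|by apply: ds; exact: csmoothX].
rewrite ih exprS -natr1; ring.
Qed.

End ComplexSmoothness.

(** * Complex Green identities and exponentials on the circle *)

Section ComplexGreen.
Context {R : realType}.
Local Notation plane := (R * R)%type.
Local Notation mu := (@lebesgue_measure R).
Implicit Types (u v : plane -> R[i]) (a b rho s t : R).

Lemma measurable_angles : measurable (angles : set R).
Proof. exact: measurable_itv. Qed.

Lemma continuous_integrable_angles (f : R -> R) : continuous f ->
  mu.-integrable angles (EFin \o f).
Proof.
move=> cf; apply: continuous_compact_integrable; first exact: segment_compact.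
exact: continuous_subspaceT.
Qed.

Lemma ccontinuous_integrable_angles (f : R -> R[i]) : ccontinuous f ->
  cintegrable mu angles f.
Proof. by move=> [f1 f2]; split; exact: continuous_integrable_angles. Qed.

Lemma ccontinuous_integrable_rdisk u a b rho : 0 < rho -> ccontinuous u ->
  cintegrable plane_measure (rdisk a b rho) u.
Proof. by move=> rho0 [u1 u2]; split; exact: continuous_integrable_rdisk. Qed.

Lemma cintegral_rdisk_e1 u a b rho : 0 < rho -> csmooth u ->
  cintegral plane_measure (rdisk a b rho) (cpartial e1 u) =
  circle_int (fun t => u (a + rho * cos t, b + rho * sin t) * (rho * cos t)%:C).
Proof.
move=> rho0 [u1 u2]; apply: complex_eqP => /=; rewrite Rintegral_rdisk_e1//;
  try exact: smooth_continuous; try (by move=> p; exact: smooth_derivable1).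
- by apply: eq_Rintegral => t _; rewrite Re_mul /= mulr0 subr0.
- exact/smooth_continuous/smooth_D1.
- by apply: eq_Rintegral => t _; rewrite Im_mul /= mulr0 add0r.
- exact/smooth_continuous/smooth_D1.
Qed.

Lemma cintegral_rdisk_e2 u a b rho : 0 < rho -> csmooth u ->
  cintegral plane_measure (rdisk a b rho) (cpartial e2 u) =
  circle_int (fun t => u (a + rho * cos t, b + rho * sin t) * (rho * sin t)%:C).
Proof.
move=> rho0 [u1 u2]; apply: complex_eqP => /=; rewrite Rintegral_rdisk_e2//;
  try exact: smooth_continuous; try (by move=> p; exact: smooth_derivable2).
- by apply: eq_Rintegral => t _; rewrite Re_mul /= mulr0 subr0.
- exact/smooth_continuous/smooth_D2.
- by apply: eq_Rintegral => t _; rewrite Im_mul /= mulr0 add0r.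
- exact/smooth_continuous/smooth_D2.
Qed.

Lemma cisD x y : cis (x + y) = cis x * cis y :> R[i].
Proof. by apply: complex_eqP; rewrite !ReImE /= ?cosD ?sinD// addrC. Qed.

Lemma cis0 : cis 0 = 1 :> R[i].
Proof. by rewrite /cis cos0 sin0. Qed.

Lemma cisN x : cis (- x) = (cis x)^* :> R[i].
Proof. by apply: complex_eqP; rewrite !ReImE /= ?cosN ?sinN. Qed.

Lemma cisX x n : cis x ^+ n = cis (n%:R * x) :> R[i].
Proof.
elim: n => [|n ih]; first by rewrite mul0r cis0.
by rewrite exprS ih -cisD -nat1r mulrDl mul1r.
Qed.

Lemma ccontinuous_cis s : ccontinuous (fun t : R => cis (s * t)).
Proof.
have cs : continuous (fun t : R => s * t) by move=> t; apply: cvgM; [exact: cvg_cst|exact: cvg_id].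
split => t /=.
  by apply: (@continuous_comp _ _ _ (fun t => s * t) cos); [exact: cs|exact: continuous_cos].
by apply: (@continuous_comp _ _ _ (fun t => s * t) sin); [exact: cs|exact: continuous_sin].
Qed.

(** For [k] nonzero, sin (k t) / k and - cos (k t) / k are primitives of the two parts, with equal
    values at 0 and 2 pi. *)
Lemma circle_int_cis (k : int) :
  circle_int (fun t => cis (k%:~R * t)) = if k == 0 then (2 * pi)%:C else 0 :> R[i].
Proof.
have pi0 := pi_gt0 R.
have [->|k0] := eqVneq k 0.
  apply: complex_eqP => /=.
    under eq_Rintegral do rewrite mul0r cos0.
    rewrite Rintegral_cst; last exact: measurable_angles.
    rewrite mul1r [X in fine X](_ : _ = mu [set` `[0 : R, 2 * pi]])//.
    rewrite lebesgue_measure_itv /= lte_fin mulr_gt0//=.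
    by rewrite subr0.
  under eq_Rintegral do rewrite mul0r sin0.
  by rewrite Rintegral_cst; [rewrite mul0r|exact: measurable_angles].
have kR : (k%:~R : R) != 0 by rewrite intr_eq0.
have [cc cs] := ccontinuous_cis (k%:~R).
have per : cis (k%:~R * (2 * pi)) = 1 :> R[i].
  rewrite -[k]mulr1 intrM.
  have P n : cis (n%:R * (2 * pi)) = 1 :> R[i].
    by rewrite -cisX /cis [2 * pi]mulr_natl cos2pi sin2pi expr1n.
  case: (intP k) => [|n|n]; rewrite ?mulr1.
  - by rewrite mul0r cis0.
  - exact: P.
  - by rewrite mulrNz mulNr cisN P conjc1.
have cos2 : cos (k%:~R * (2 * pi)) = 1 :> R := congr1 (@complex.Re R) per.
have sin2 : sin (k%:~R * (2 * pi)) = 0 :> R := congr1 (@complex.Im R) per.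
have FTC0 (f F : R -> R) : continuous f -> (forall t, is_derive t (1 : R) F (f t)) ->
    F (2 * pi) = F 0 -> \int[mu]_(t in angles) f t = 0.
  move=> cf dF FE; have pi2 : 0 <= 2 * pi :> R by lra.
  by have /(congr1 fine) := is_derive_FTC pi2 cf dF; rewrite FE subrr.
apply: complex_eqP => /=.
  apply: (FTC0 _ (fun t => (k%:~R)^-1 * sin (k%:~R * t))) => //.
    by move=> t; apply: is_derive_eq; rewrite [_%:A]mulr1 [_ *: _]mulrA; field.
  by rewrite sin2 !mulr0 sin0 mulr0.
apply: (FTC0 _ (fun t => - (k%:~R)^-1 * cos (k%:~R * t))) => //.
  by move=> t; apply: is_derive_eq; rewrite [_%:A]mulr1 [_ *: _]mulrA; field.
by rewrite cos2 mulr0 cos0.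
Qed.

End ComplexGreen.

(** * Continuity, for the L^2 norm, of the pairing with a bounded function *)

Section BoundedPairing.
Context d (T : measurableType d) (R : realType).
Variables (mu : {measure set T -> \bar R}) (D : set T).
Hypotheses (mD : measurable D) (fD : (mu D < +oo)%E).
Implicit Types f g : T -> R[i].

Definition cmeasurable f :=
  measurable_fun D (fun x => complex.Re (f x)) /\ measurable_fun D (fun x => complex.Im (f x)).

Lemma cmeasurableM f g : cmeasurable f -> cmeasurable g -> cmeasurable (fun x => f x * g x).
Proof.
move=> [f1 f2] [g1 g2]; split.
  under eq_fun do rewrite Re_mul.
  by apply: measurable_funB; exact: measurable_funM.
under eq_fun do rewrite Im_mul.
by apply: measurable_funD; exact: measurable_funM.
Qed.

Lemma cmeasurable_conj f : cmeasurable f -> cmeasurable (fun x => (f x)^*).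
Proof.
move=> [f1 f2]; split; first by under eq_fun do rewrite Re_cconj.
under eq_fun do rewrite Im_cconj; exact: measurableT_comp.
Qed.

Lemma inL2B f g : inL2 mu D f -> inL2 mu D g -> inL2 mu D (fun x => f x - g x).
Proof.
move=> [f1 f2 f3] [g1 g2 g3].
have m1 : measurable_fun D (fun x => complex.Re (f x - g x)).
  under eq_fun do rewrite Re_add Re_opp.
  exact: measurable_funB.
have m2 : measurable_fun D (fun x => complex.Im (f x - g x)).
  under eq_fun do rewrite Im_add Im_opp.
  exact: measurable_funB.
split => //.
(* The domination is |f - g|^2 <= 2 |f|^2 + 2 |g|^2. *)
apply: (@le_integrable _ _ _ mu D mD _
  (EFin \o (fun x => 2 * normc (f x) ^+ 2 + 2 * normc (g x) ^+ 2))).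
- apply/measurable_EFinP; under eq_fun do rewrite normc_sqr.
  by apply: measurable_funD; exact: measurable_funX.
- move=> x _ /=; rewrite lee_fin !ger0_norm ?addr_ge0 ?mulr_ge0 ?sqr_ge0 ?normc_ge0//.
  rewrite !normc_sqr !ReImE.
  set a := complex.Re (f x); set b := complex.Im (f x).
  set a' := complex.Re (g x); set b' := complex.Im (g x).
  have := sqr_ge0 (a + a'); have := sqr_ge0 (b + b'); nra.
- exact: (integrable_lin mD 2 2 f3 g3).
Qed.

Lemma integrable_cst_fin (c : R) : mu.-integrable D (EFin \o (fun=> c)).
Proof.
apply: measurable_bounded_integrable => //.
by exists `|c|; split => // M cM x _; exact: ltW.
Qed.

Lemma bounded_pairing_cintegrable g f M : cmeasurable g ->
  (forall x, D x -> normc (g x) <= M) -> inL2 mu D f ->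
  cintegrable mu D (fun x => g x * (f x)^*).
Proof.
move=> mg gM [f1 f2 f3].
have [m1 m2] : cmeasurable (fun x => g x * (f x)^*).
  by apply: cmeasurableM => //; apply: cmeasurable_conj.
(* On a set of finite measure, |f| <= 1 + |f|^2 makes a square integrable function integrable. *)
have bnd x : D x -> normc (g x * (f x)^*) <= M * 1 + M * normc (f x) ^+ 2.
  move=> Dx; rewrite normcM normc_conj -mulrDr.
  have n0 := normc_ge0 (f x); have M0 := le_trans (normc_ge0 (g x)) (gM x Dx).
  apply: ler_pM => //; [exact: normc_ge0|exact: gM|].
  have := sqr_ge0 (normc (f x) - 1); nra.
have ib : mu.-integrable D (EFin \o (fun x => M * 1 + M * normc (f x) ^+ 2)).
  by apply: (integrable_lin mD _ _ _ f3); exact: integrable_cst_fin.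
split; apply: (le_integrable mD _ _ ib); try exact/measurable_EFinP;
  move=> x Dx /=; rewrite lee_fin; apply: le_trans (le_trans (bnd x Dx) (ler_norm _)).
- exact: Re_le_normc.
- exact: Im_le_normc.
Qed.

Lemma L2norm_ge0 f : 0 <= L2norm mu D f.
Proof. exact: sqrtr_ge0. Qed.

(* AM-GM: |g f| <= M (e + |f|^2 / e) for every e > 0; taking e = L2norm f
   replaces Cauchy-Schwarz. *)
Lemma bounded_pairing_le g f M (h : T -> R) : cmeasurable g ->
  (forall x, D x -> normc (g x) <= M) -> inL2 mu D f -> 0 <= M ->
  mu.-integrable D (EFin \o h) ->
  (forall x, D x -> `|h x| <= normc (g x * (f x)^*)) ->
  `|\int[mu]_(x in D) h x| <= M * (fine (mu D) + 1) * L2norm mu D f.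
Proof.
move=> mg gM [f1 f2 f3] M0 ih hle.
have bound e : 0 < e -> `|\int[mu]_(x in D) h x| <=
    M * e * fine (mu D) + M * e^-1 * L2norm mu D f ^+ 2.
  move=> e0; apply: le_trans (le_normr_Rintegral mD ih) _.
  rewrite sqr_sqrtr; last by apply: Rintegral_ge0 => x _; exact: sqr_ge0.
  have -> : M * e * fine (mu D) = M * e * \int[mu]_(x in D) 1.
    by rewrite Rintegral_cst// mul1r.
  rewrite -Rintegral_lin//; last exact: integrable_cst_fin.
  apply: le_Rintegral => //.
  - by have := integrable_norm ih.
  - by apply: (integrable_lin mD _ _ _ f3); exact: integrable_cst_fin.
  - move=> x Dx; apply: le_trans (hle x Dx) _.
    rewrite normcM normc_conj mulr1 -!mulrA -mulrDr.
    apply: ler_pM => //; [exact: normc_ge0|exact: normc_ge0|exact: gM|].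
    rewrite -(ler_pM2l e0) mulrDr mulrA mulfV ?gt_eqF// mul1r.
    have := sqr_ge0 (normc (f x) - e); have := normc_ge0 (f x); nra.
have := L2norm_ge0 f; rewrite le_eqVlt => /predU1P[f0|fp]; last first.
  rewrite (le_trans (bound _ fp))// le_eqVlt; apply/orP; left; apply/eqP.
  by field; rewrite gt_eqF.
(* For zero norm the bound reduces to M e mu(D) with e arbitrarily small; the added 1 keeps the
   divisor positive. *)
rewrite -f0 mulr0; apply/ler_addgt0Pr => e e0; rewrite add0r.
have A0 : 0 < M * fine (mu D) + 1 by rewrite ltr_wpDl// mulr_ge0// fine_ge0.
apply: le_trans (bound (e / (M * fine (mu D) + 1)) _) _; first exact: divr_gt0.
rewrite -f0 expr0n/= mulr0 addr0 mulrA [leLHS]mulrAC ler_pdivrMr//.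
by lra.
Qed.

Lemma bounded_pairing_cvg0 g (f : nat -> T -> R[i]) M : cmeasurable g ->
  (forall x, D x -> normc (g x) <= M) -> 0 <= M -> (forall k, inL2 mu D (f k)) ->
  L2norm mu D (f k) @[k --> \oo] --> (0 : R) ->
  complex.Re (cintegral mu D (fun x => g x * (f k x)^*)) @[k --> \oo] --> (0 : R) /\
  complex.Im (cintegral mu D (fun x => g x * (f k x)^*)) @[k --> \oo] --> (0 : R).
Proof.
move=> mg gM M0 if2 f0.
have cv (X : nat -> R) : (forall k, `|X k| <= M * (fine (mu D) + 1) * L2norm mu D (f k)) ->
    X k @[k --> \oo] --> (0 : R).
  move=> XB; apply/norm_cvg0P; apply: (@squeeze_cvgr _ _ _ _ (cst 0)
    (fun k => M * (fine (mu D) + 1) * L2norm mu D (f k))).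
  - by near=> k; rewrite /= normr_ge0 XB.
  - exact: cvg_cst.
  - by rewrite -[X in _ --> X](mulr0 (M * (fine (mu D) + 1))); apply: cvgM => //; exact: cvg_cst.
have ci k := bounded_pairing_cintegrable mg gM (if2 k).
split; apply: cv => k; apply: (bounded_pairing_le mg gM (if2 k) M0); try by case: (ci k).
- by move=> x _; exact: Re_le_normc.
- by move=> x _; exact: Im_le_normc.
Unshelve. all: by end_near. Qed.

End BoundedPairing.

(** * Smooth functions as elements of H^1 with a trace *)

Section UnitDisk.
Context {R : realType}.
Local Notation plane := (R * R)%type.
Local Notation mu := (@lebesgue_measure R).
Implicit Types (u v w : plane -> R[i]) (a b rho : R).

Lemma unit_disk_rdisk : unit_disk = rdisk 0 0 1 :> set plane.
Proof. by rewrite /unit_disk -disk_rdisk. Qed.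

Lemma circle_pointE (t : R) : (0 + 1 * cos t, 0 + 1 * sin t) = circle_point t.
Proof. by rewrite !add0r !mul1r. Qed.

Lemma continuous_circle_point : continuous (@circle_point R).
Proof. by apply: continuous_pair; [exact: continuous_cos|exact: continuous_sin]. Qed.

Lemma circle_point_notin (t : R) : ~ unit_disk (circle_point t).
Proof. by rewrite unit_disk_rdisk /rdisk /= !subr0 expr1n cos2Dsin2 ltxx. Qed.

Lemma continuous_normc_sqr (T : topologicalType) (f : T -> R[i]) : ccontinuous f ->
  continuous (fun x => normc (f x) ^+ 2).
Proof.
move=> [f1 f2]; under eq_fun do rewrite normc_sqr.
by move=> x; apply: cvgD; apply: cvgM; do ?[exact: f1|exact: f2].
Qed.

Lemma ccontinuous_inL2_rdisk u a b rho : 0 < rho -> ccontinuous u ->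
  inL2 plane_measure (rdisk a b rho) u.
Proof.
move=> rho0 cu; have [u1 u2] := cu; split.
- by apply: measurable_funTS; exact: continuous_measurable_plane.
- by apply: measurable_funTS; exact: continuous_measurable_plane.
- exact: (continuous_integrable_rdisk a b rho0 (continuous_normc_sqr cu)).
Qed.

Lemma ccontinuous_circle_L2 (f : R -> R[i]) : ccontinuous f -> circle_L2 f.
Proof.
move=> cf; have [f1 f2] := cf; split.
- by apply: measurable_funTS; exact: continuous_measurable_fun.
- by apply: measurable_funTS; exact: continuous_measurable_fun.
- exact: (continuous_integrable_angles (continuous_normc_sqr cf)).
Qed.

Lemma ccontinuous_bounded_rdisk u a b rho : 0 < rho -> ccontinuous u ->
  exists2 M, 0 <= M & forall p, rdisk a b rho p -> normc (u p) <= M.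
Proof.
move=> rho0 cu.
have [M M0 MB] := continuous_bounded_rdisk a b rho0 (continuous_normc_sqr cu).
(* By x <= 1 + x^2, a bound on the squared modulus yields one on the modulus. *)
exists (1 + M) => [|p /MB]; first by lra.
by have := normc_ge0 (u p); rewrite ger0_norm ?sqr_ge0//; nra.
Qed.

(* A test function vanishes on the circle, so that the boundary term of Green's
   identity for w phi is zero. *)
Lemma csmooth_weak_partial e w : e = e1 \/ e = e2 -> csmooth w ->
  weak_partial unit_disk e w (cpartial e w).
Proof.
move=> he sw phi [sphi [K [_ KD phi0]]].
have sphiC := csmooth_real sphi.
have sD : csmooth (fun p => ('D_e phi p)%:C).
  by apply: csmooth_real; case: he => ->; [exact: smooth_D1|exact: smooth_D2].
have sp : csmooth (cpartial e w).
  by case: he => ->; [exact: csmooth_cpartial1|exact: csmooth_cpartial2].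
have dw u p : csmooth u -> cderivable u p e.
  by case: he => -> su; [exact: csmooth_cderivable1|exact: csmooth_cderivable2].
have ci u : csmooth u -> cintegrable plane_measure unit_disk u.
  move=> su; rewrite unit_disk_rdisk; apply: ccontinuous_integrable_rdisk => //.
  exact: csmooth_ccontinuous.
have mD : measurable (unit_disk : set (measurableTypeR R * measurableTypeR R)).
  by rewrite unit_disk_rdisk; exact: measurable_rdisk.
have boundary0 (h : R -> R) : circle_int (fun t =>
    w (0 + 1 * cos t, 0 + 1 * sin t) * (phi (0 + 1 * cos t, 0 + 1 * sin t))%:C * (h t)%:C) = 0.
  rewrite -[RHS](@cintegral0 _ _ _ mu angles measurable_angles).
  apply: eq_cintegral => t _; rewrite circle_pointE phi0 ?mulr0 ?mul0r//.
  by move=> /KD; exact: circle_point_notin.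
have green0 : cintegral plane_measure unit_disk (cpartial e (fun p => w p * (phi p)%:C)) = 0.
  rewrite unit_disk_rdisk; have swphi := csmoothM sw sphiC.
  by case: he => ->; [rewrite cintegral_rdisk_e1//|rewrite cintegral_rdisk_e2//]; exact: boundary0.
apply/eqP; rewrite -addr_eq0 -cintegralD//; [|by apply: ci; exact: csmoothM..].
apply/eqP; rewrite -green0; apply: eq_cintegral => p _.
by rewrite cpartialM; [rewrite cpartial_real addrC|exact: dw|exact: dw].
Qed.

Lemma csmooth_inL2 u : csmooth u -> inL2 plane_measure unit_disk u.
Proof.
move=> su; rewrite unit_disk_rdisk; apply: ccontinuous_inL2_rdisk => //.
exact: csmooth_ccontinuous.
Qed.

Lemma csmooth_inH1 w : csmooth w ->
  inH1 unit_disk w (fun p => (cpartial e1 w p, cpartial e2 w p)).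
Proof.
move=> sw; split => /=.
- exact: csmooth_inL2.
- by apply: csmooth_inL2; exact: csmooth_cpartial1.
- by apply: csmooth_inL2; exact: csmooth_cpartial2.
- by apply: csmooth_weak_partial => //; left.
- by apply: csmooth_weak_partial => //; right.
Qed.

Lemma L2norm0 d (T : measurableType d) (m : {measure set T -> \bar R}) (D : set T) (f : T -> R[i]) :
  measurable D -> L2norm m D (fun x => f x - f x) = 0.
Proof.
move=> mD; rewrite /L2norm; under eq_Rintegral do rewrite subrr normc0 expr0n/=.
by rewrite Rintegral_cst// mul0r sqrtr0.
Qed.

(** The constant sequence [w] is an admissible approximation. *)
Lemma csmooth_is_trace w : csmooth w ->
  is_trace w (fun p => (cpartial e1 w p, cpartial e2 w p)) (fun t => w (circle_point t)).
Proof.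
move=> sw; split.
  apply: ccontinuous_circle_L2; apply: ccontinuous_comp; first exact: continuous_circle_point.
  exact: csmooth_ccontinuous.
have mD : measurable (unit_disk : set (measurableTypeR R * measurableTypeR R)).
  by rewrite unit_disk_rdisk; exact: measurable_rdisk.
exists (fun=> w); split=> [//||||].
- by rewrite L2norm0//; exact: cvg_cst.
- by rewrite L2norm0//; exact: cvg_cst.
- by rewrite L2norm0//; exact: cvg_cst.
- by rewrite /circle_norm L2norm0; [exact: cvg_cst|exact: measurable_angles].
Qed.

End UnitDisk.

(** * Powers of z and of its conjugate under the Cauchy-Riemann operators *)

Section HarmonicMonomials.
Context {R : realType}.
Local Notation plane := (R * R)%type.
Local Notation mu := (@lebesgue_measure R).
Implicit Types (u v w : plane -> R[i]) (a b rho : R).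

(* [zeta 1] is the coordinate z and [zeta (- 1)] its conjugate. *)
Definition zeta (s : R) (p : plane) : R[i] := p.1 +i* (s * p.2).

(** Twice the Wirtinger derivative in conj(z) for [s = 1], and twice the one in z for [s = - 1]; in
    both cases it annihilates the powers of [zeta s]. *)
Definition dbar (s : R) u (p : plane) : R[i] :=
  cpartial e1 u p + (0 +i* s) * cpartial e2 u p.

Lemma csmooth_zeta s : csmooth (zeta s).
Proof.
split; first exact: smooth_fst.
by apply: smoothM; [exact: smooth_cst|exact: smooth_snd].
Qed.

Lemma cpartial_zeta s (p e : plane) : cpartial e (zeta s) p = e.1 +i* (s * e.2).
Proof.
have [_ D1] := is_derive_fst_coord p e; have [d2 D2] := is_derive_snd_coord p e.
apply: complex_eqP => //=.
by rewrite derive_mul// D2 derive_cst mul0r add0r.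
Qed.

Lemma cpartial1_zetaX s n p : cpartial e1 (fun p => zeta s p ^+ n.+1) p =
  n.+1%:R * zeta s p ^+ n.
Proof.
rewrite cpartialX; [|by move=> *; exact: csmooth_cderivable1|exact: csmooth_zeta].
by rewrite cpartial_zeta /= mulr0 mulr1.
Qed.

Lemma cpartial2_zetaX s n p : cpartial e2 (fun p => zeta s p ^+ n.+1) p =
  n.+1%:R * zeta s p ^+ n * (0 +i* s).
Proof.
rewrite cpartialX; [|by move=> *; exact: csmooth_cderivable2|exact: csmooth_zeta].
by rewrite cpartial_zeta /= mulr1.
Qed.

Lemma csmooth_zetaX s n : csmooth (fun p => zeta s p ^+ n).
Proof. by apply: csmoothX; exact: csmooth_zeta. Qed.

Lemma imul_sqr s t : (0 +i* s) * (0 +i* t) = (- (s * t))%:C :> R[i].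
Proof. by apply: complex_eqP; rewrite !ReImE /= ?mul0r ?mulr0 ?addr0 ?sub0r. Qed.

(** For signs [s] and [t] the last factor is 0 if they agree and 2 if they differ: the first case is
    holomorphy, the second gives the moments. *)
Lemma dbar_zetaX s t n p : dbar s (fun p => zeta t p ^+ n.+1) p =
  n.+1%:R * zeta t p ^+ n * (1 - s * t)%:C.
Proof.
rewrite /dbar cpartial1_zetaX cpartial2_zetaX mulrCA imul_sqr.
by rewrite rmorphB rmorphN /= rmorph1 mulrBr mulr1 mulrN.
Qed.

Lemma dbarM s u v p : csmooth u -> csmooth v ->
  dbar s (fun p => u p * v p) p = dbar s u p * v p + u p * dbar s v p.
Proof.
move=> su sv; rewrite /dbar !cpartialM; first ring;
  by [exact: csmooth_cderivable1|exact: csmooth_cderivable2].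
Qed.

(** The two components of the normal combine into cos t + i s sin t, which is [cis (s * t)] because
    [s] is a sign. *)
Lemma green_dbar s u a b rho : s = 1 \/ s = -1 -> 0 < rho -> csmooth u ->
  cintegral plane_measure (rdisk a b rho) (dbar s u) =
  circle_int (fun t => u (a + rho * cos t, b + rho * sin t) * (rho%:C * cis (s * t))).
Proof.
move=> hs rho0 su.
have ci v : csmooth v -> cintegrable plane_measure (rdisk a b rho) v.
  by move=> sv; apply: ccontinuous_integrable_rdisk => //; exact: csmooth_ccontinuous.
have mD := @measurable_rdisk R a b rho.
have s1 := csmooth_cpartial1 su; have s2 := csmooth_cpartial2 su.
rewrite cintegralD//; [|exact: ci|by apply: ci; apply: csmoothM => //; exact: csmooth_cst].
rewrite cintegralZ//; last exact: ci.
rewrite cintegral_rdisk_e1// cintegral_rdisk_e2//.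
have cb (h : R -> R) : continuous h -> cintegrable mu angles
    (fun t => u (a + rho * cos t, b + rho * sin t) * (rho * h t)%:C).
  move=> ch; apply: ccontinuous_integrable_angles; apply: ccontinuousM.
    apply: (@ccontinuous_comp _ _ _ (fun t => (a + rho * cos t, b + rho * sin t)) u).
      exact: continuous_circle.
    exact: csmooth_ccontinuous.
  by apply: ccontinuous_real => t; apply: cvgM; [exact: cvg_cst|exact: ch].
have cbc := cb _ (@continuous_cos R); have cbs := cb _ (@continuous_sin R).
have mA := @measurable_angles R.
rewrite /circle_int -cintegralZ// -cintegralD//; last exact: cintegrableZ.
apply: eq_cintegral => t _; rewrite mulrCA -mulrDr; congr (_ * _).
apply: complex_eqP; rewrite !ReImE /=; case: hs => ->; rewrite ?mul1r ?mulN1r ?cosN ?sinN; ring.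
Qed.

End HarmonicMonomials.

(** * The Neumann problem for monomials, tested against smooth functions *)

Section NeumannProblem.
Context {R : realType}.
Local Notation plane := (R * R)%type.
Local Notation mu := (@lebesgue_measure R).
Variables (s : R) (n : nat) (c : R[i]).
Hypothesis hs : s = 1 \/ s = -1.

(** The amplitude [c] is general because it is used both as the normalization of the Fourier basis
    and as [c / n.+1], with which the same formula describes the trace of the solution. The
    frequency is [n.+1], so that the gradient has exponent [n]. *)
Definition neumann_data (t : R) : R[i] := c * cis (s * (n.+1%:R * t)).

Definition monomial_solution (p : plane) : R[i] := c / n.+1%:R * zeta s p ^+ n.+1.

Definition monomial_gradient (p : plane) : R[i] * R[i] :=
  (c * zeta s p ^+ n, c * zeta s p ^+ n * (0 +i* s)).

Lemma csmooth_monomial_solution : csmooth monomial_solution.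
Proof. by apply: csmoothM; [exact: csmooth_cst|exact: csmooth_zetaX]. Qed.

Lemma monomial_gradientE : monomial_gradient =
  (fun p => (cpartial e1 monomial_solution p, cpartial e2 monomial_solution p)).
Proof.
have n0 : (n.+1%:R : R[i]) != 0 by rewrite pnatr_eq0.
have csm := csmooth_cst (c / n.+1%:R); have sz := @csmooth_zetaX R s n.+1.
apply/funext => p; rewrite /monomial_solution.
rewrite (cpartialM (csmooth_cderivable1 p csm) (csmooth_cderivable1 p sz)).
rewrite (cpartialM (csmooth_cderivable2 p csm) (csmooth_cderivable2 p sz)).
rewrite cpartial1_zetaX cpartial2_zetaX !cpartial_cst !mul0r !add0r.
by congr pair; field.
Qed.

Lemma zeta_circle_point t : zeta s (circle_point t) = cis (s * t).
Proof. by rewrite /zeta /cis /=; case: hs => ->; rewrite ?mul1r// !mulN1r cosN sinN. Qed.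

Lemma sqr_sign : s * s = 1.
Proof. by case: hs => ->; rewrite ?mulrNN mulr1. Qed.

Lemma neumann_dataE t : c * zeta s (circle_point t) ^+ n * cis (s * t) = neumann_data t.
Proof.
by rewrite zeta_circle_point cisX -mulrA -cisD /neumann_data mulrCA -mulrDr -[in RHS]natr1 mulrDl mul1r.
Qed.

Lemma ccontinuous_neumann_data : ccontinuous neumann_data.
Proof.
apply: ccontinuousM; first exact: ccontinuous_cst.
under eq_fun do rewrite mulrA; exact: ccontinuous_cis.
Qed.

Lemma neumann_data_int : circle_int neumann_data = 0.
Proof.
have [k [k0 kE]] : exists k : int, k != 0 /\ forall t, s * (n.+1%:R * t) = k%:~R * t.
  case: hs => ->; first by exists (n.+1 : int); split => // t; rewrite mul1r.
  by exists (- (n.+1 : int)); split => [|t]; [rewrite oppr_eq0|rewrite mulN1r mulrNz mulNr].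
rewrite /circle_int /neumann_data; under [cintegral _ _ _]eq_cintegral => t _ do rewrite kE.
have mA := @measurable_angles R.
rewrite cintegralZ//; last exact/ccontinuous_integrable_angles/ccontinuous_cis.
by have := circle_int_cis (R := R) k; rewrite (negbTE k0) /circle_int => ->; rewrite mulr0.
Qed.

Lemma neumann_data_L2diamond : L2diamond neumann_data.
Proof.
split; last exact: neumann_data_int.
exact/ccontinuous_circle_L2/ccontinuous_neumann_data.
Qed.

(** The gradient is c zeta^n times (1, i s), so its product with the conjugate gradient of [u] is c
    zeta^n times [dbar s] of conj(u). On the circle, the factor [cis (s * t)] of Green's identity
    raises the frequency from [n] to [n.+1]. *)
Lemma monomial_green u : csmooth u ->
  cintegral plane_measure unit_disk
    (fun p => cdot (monomial_gradient p) (cpartial e1 u p, cpartial e2 u p)) =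
  circle_inner neumann_data (fun t => u (circle_point t)).
Proof.
move=> su; have su' := csmooth_conj su.
have sv : csmooth (fun p => c * zeta s p ^+ n * (u p)^*).
  by apply: csmoothM su'; apply: csmoothM; [exact: csmooth_cst|exact: csmooth_zetaX].
have := green_dbar 0 0 hs (ltr01 : 0 < 1 :> R) sv.
rewrite -unit_disk_rdisk => E; transitivity (cintegral plane_measure unit_disk
    (dbar s (fun p => c * zeta s p ^+ n * (u p)^*))).
  apply: eq_cintegral => p _.
  have dz : dbar s (fun p => c * zeta s p ^+ n) p = 0.
    rewrite dbarM; [|exact: csmooth_cst|exact: csmooth_zetaX].
    rewrite {1}/dbar !cpartial_cst mulr0 addr0 mul0r add0r.
    case: n => [|n']; last by rewrite dbar_zetaX sqr_sign subrr !mulr0.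
    by rewrite /dbar !cpartial_cst mulr0 addr0 mulr0.
  rewrite dbarM//; last by apply: csmoothM; [exact: csmooth_cst|exact: csmooth_zetaX].
  rewrite dz mul0r add0r /dbar /cdot /= !cpartial_conj;
    [|exact: csmooth_cderivable2|exact: csmooth_cderivable1].
  by rewrite mulrDr !mulrA.
rewrite {}E; apply: eq_cintegral => t _.
by rewrite circle_pointE mul1r mulrAC neumann_dataE.
Qed.

End NeumannProblem.

(** * From smooth test functions to all of H^1 *)

Section NeumannSolution.
Context {R : realType}.
Local Notation plane := (R * R)%type.
Local Notation mu := (@lebesgue_measure R).

Lemma inL2_cmeasurable d (T : measurableType d) (m : {measure set T -> \bar R}) (D : set T)
  (f : T -> R[i]) : inL2 m D f -> cmeasurable D f.
Proof. by case. Qed.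

Lemma bounded_pairing_limit d (T : measurableType d) (m : {measure set T -> \bar R})
    (D : set T) (g f : T -> R[i]) (u : nat -> T -> R[i]) (M : R) :
  measurable D -> (m D < +oo)%E -> cmeasurable D g ->
  (forall x, D x -> normc (g x) <= M) -> 0 <= M ->
  inL2 m D f -> (forall k, inL2 m D (u k)) ->
  L2norm m D (fun x => u k x - f x) @[k --> \oo] --> (0 : R) ->
  complex.Re (cintegral m D (fun x => g x * (u k x)^*)) @[k --> \oo] -->
    complex.Re (cintegral m D (fun x => g x * (f x)^*)) /\
  complex.Im (cintegral m D (fun x => g x * (u k x)^*)) @[k --> \oo] -->
    complex.Im (cintegral m D (fun x => g x * (f x)^*)).
Proof.
move=> mD fD mg gM M0 f2 u2 uf.
have E k : cintegral m D (fun x => g x * (u k x)^*) =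
    cintegral m D (fun x => g x * (u k x - f x)^*) + cintegral m D (fun x => g x * (f x)^*).
  rewrite -cintegralD//.
  - by apply: eq_cintegral => x _; rewrite -mulrDr -rmorphD /= subrK.
  - exact: (bounded_pairing_cintegrable mD fD mg gM (inL2B mD (u2 k) f2)).
  - exact: (bounded_pairing_cintegrable mD fD mg gM f2).
have [] := bounded_pairing_cvg0 mD fD mg gM M0 (fun k => inL2B mD (u2 k) f2) uf.
move=> c1 c2; split.
  under eq_fun do rewrite E Re_add.
  have := cvgD c1 (cvg_cst (complex.Re (cintegral m D (fun x => g x * (f x)^*)))).
  by rewrite add0r => cE; apply: cE.
under eq_fun do rewrite E Im_add.
have := cvgD c2 (cvg_cst (complex.Im (cintegral m D (fun x => g x * (f x)^*)))).
by rewrite add0r => cE; apply: cE.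
Qed.

(** Green's identity holds for each smooth approximant [u k] in the definition of the trace. Its
    gradients and boundary values converge in L^2 and are paired with bounded functions, so both
    sides converge, and uniqueness of limits gives the identity for [v]. *)
Lemma monomial_neumann_solution (s : R) (n : nat) (c : R[i]) : s = 1 \/ s = -1 ->
  neumann_solution (neumann_data s n c) (monomial_solution s n c) (monomial_gradient s n c).
Proof.
move=> hs; have sw := csmooth_monomial_solution s n c.
split.
- by rewrite monomial_gradientE; exact: csmooth_inH1.
- move=> v Gv tv [v2 G1 G2 _ _] [tv2 [u [su _ u1 u2 ut]]].
  pose g1 p := (monomial_gradient s n c p).1; pose g2 p := (monomial_gradient s n c p).2.
  have sg1 : csmooth g1 by apply: csmoothM; [exact: csmooth_cst|exact: csmooth_zetaX].
  have sg2 : csmooth g2 by apply: csmoothM => //; exact: csmooth_cst.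
  have mD : measurable (unit_disk : set (measurableTypeR R * measurableTypeR R)).
    by rewrite unit_disk_rdisk; exact: measurable_rdisk.
  have fD : (plane_measure (unit_disk : set plane) < +oo)%E.
    by rewrite unit_disk_rdisk; exact: plane_measure_rdisk_lty.
  have fA : (mu angles < +oo)%E.
    by rewrite [X in (X < _)%E]lebesgue_measure_itv/=; case: ifP => _; rewrite -?EFinB ltry.
  have gB (g : plane -> R[i]) : csmooth g -> exists2 M, 0 <= M & forall p, unit_disk p -> normc (g p) <= M.
    by rewrite unit_disk_rdisk => sg; apply: ccontinuous_bounded_rdisk => //; exact: csmooth_ccontinuous.
  have [M1 M10 g1M] := gB _ sg1; have [M2 M20 g2M] := gB _ sg2.
  have hB t : angles t -> normc (neumann_data s n c t) <= normc c.
    by rewrite /neumann_data normcM /= cos2Dsin2 sqrtr1 mulr1.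
  have cm (g : plane -> R[i]) : csmooth g -> cmeasurable (unit_disk : set (measurableTypeR R * measurableTypeR R)) g.
    by move=> sg; exact: (inL2_cmeasurable (csmooth_inL2 sg)).
  have cmh : cmeasurable angles (neumann_data s n c).
    exact: (inL2_cmeasurable (ccontinuous_circle_L2 (ccontinuous_neumann_data s n c))).
  have du1 k := csmooth_inL2 (csmooth_cpartial1 (su k)).
  have du2 k := csmooth_inL2 (csmooth_cpartial2 (su k)).
  have tu k : circle_L2 (fun t => u k (circle_point t)).
    apply: ccontinuous_circle_L2; apply: ccontinuous_comp; first exact: continuous_circle_point.
    exact: csmooth_ccontinuous.
  have mA := @measurable_angles R.
  have [x1 y1] := bounded_pairing_limit mD fD (cm _ sg1) g1M M10 G1 du1 u1.
  have [x2 y2] := bounded_pairing_limit mD fD (cm _ sg2) g2M M20 G2 du2 u2.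
  have [x3 y3] := @bounded_pairing_limit _ _ mu angles _ _ _ _ mA fA cmh hB (normc_ge0 c) tv2 tu ut.
  have split_cdot (f1 f2 : plane -> R[i]) : inL2 plane_measure unit_disk f1 ->
      inL2 plane_measure unit_disk f2 ->
      cintegral plane_measure unit_disk (fun p => g1 p * (f1 p)^* + g2 p * (f2 p)^*) =
      cintegral plane_measure unit_disk (fun p => g1 p * (f1 p)^*) +
      cintegral plane_measure unit_disk (fun p => g2 p * (f2 p)^*).
    move=> i1 i2; rewrite cintegralD//.
    - exact: (bounded_pairing_cintegrable mD fD (cm _ sg1) g1M i1).
    - exact: (bounded_pairing_cintegrable mD fD (cm _ sg2) g2M i2).
  have green k := monomial_green n c hs (su k).
  have E k : circle_inner (neumann_data s n c) (fun t => u k (circle_point t)) =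
      cintegral plane_measure unit_disk (fun p => g1 p * (cpartial e1 (u k) p)^*) +
      cintegral plane_measure unit_disk (fun p => g2 p * (cpartial e2 (u k) p)^*).
    by rewrite -green -split_cdot.
  rewrite [LHS](split_cdot _ _ G1 G2).
  apply: complex_eqP; rewrite ?Re_add ?Im_add.
    apply: (cvg_unique _ (cvgD x1 x2)); first exact: Rhausdorff.
    apply: cvg_trans x3; apply: near_eq_cvg; near=> k.
    by have := congr1 (@complex.Re R) (E k); rewrite Re_add => /esym.
  apply: (cvg_unique _ (cvgD y1 y2)); first exact: Rhausdorff.
  apply: cvg_trans y3; apply: near_eq_cvg; near=> k.
  by have := congr1 (@complex.Im R) (E k); rewrite Im_add => /esym.
- exists (fun t => monomial_solution s n c (circle_point t)).
    by rewrite monomial_gradientE; exact: csmooth_is_trace.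
  (* The trace of the solution is the boundary data with amplitude [c / n.+1], so its mean vanishes
     too. *)
  have := neumann_data_int n (c / n.+1%:R) hs.
  rewrite /circle_int => <-; apply: eq_cintegral => t _.
  by rewrite /monomial_solution zeta_circle_point// cisX /neumann_data mulrCA.
Unshelve. all: by end_near. Qed.

End NeumannSolution.

(** * Moments of a disk through its boundary circle *)

Section Moments.
Context {R : realType}.
Local Notation plane := (R * R)%type.
Local Notation mu := (@lebesgue_measure R).
Variables (a b r : R).
Hypothesis r0 : 0 < r.
Local Notation C := (a +i* b).

Lemma zeta1_circle t : zeta 1 (a + r * cos t, b + r * sin t) = C + r%:C * cis t.
Proof. by apply: complex_eqP; rewrite !ReImE /=; ring. Qed.

Lemma zetaN1_conj (p : plane) : zeta (-1) p = (zeta 1 p)^*.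
Proof. by apply: complex_eqP; rewrite !ReImE /=; ring. Qed.

(** The coefficient of e^(i (i + 1 - k) t), for the pair of indices (i, k), in the expansion of z^m
    conj(z)^n r e^(i t) on the circle z = C + r e^(i t). *)
Definition boundary_coef (m n i k : nat) : R[i] :=
  C ^+ (m - i) * (conjc C) ^+ (n - k) * (r%:C) ^+ (i + k).+1 * ('C(m, i))%:R * ('C(n, k))%:R.

Lemma boundary_expansion m n t :
  (C + r%:C * cis t) ^+ m * (conjc (C + r%:C * cis t)) ^+ n * (r%:C * cis t) =
  \sum_(i < m.+1) \sum_(k < n.+1) boundary_coef m n i k * cis ((i.+1%:Z - k%:Z)%:~R * t).
Proof.
have -> : conjc (C + r%:C * cis t) = conjc C + r%:C * cis (- t).
  by apply: complex_eqP; rewrite !ReImE /= ?cosN ?sinN; ring.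
rewrite !exprDn mulr_suml mulr_suml; apply: eq_bigr => i _.
rewrite mulr_sumr mulr_suml; apply: eq_bigr => k _.
have -> : cis ((i.+1%:Z - k%:Z)%:~R * t) = cis t * cis t ^+ i * cis (- t) ^+ k.
  rewrite !cisX -!cisD; congr cis.
  have -> : (i.+1%:Z - k%:Z)%:~R = 1 + i%:R - k%:R :> R by rewrite intrB nat1r.
  by ring.
rewrite /boundary_coef !exprMn -[_ *+ 'C(m, i)]mulr_natr -[_ *+ 'C(n, k)]mulr_natr exprS exprD.
move: (C ^+ _) (conjc C ^+ _) (r%:C ^+ i) (r%:C ^+ k) (cis t ^+ i) (cis (- t) ^+ k).
move: ('C(m, i)%:R) ('C(n, k)%:R) (cis t) (r%:C) => x1 x2 x3 x4 x5 x6 x7 x8 x9 x10.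
by ring.
Qed.

(** Only the terms with [k = i.+1] have frequency zero. As [k] is at most [n.+1] and [i] at most
    [m], this leaves the indices below the minimum. *)
Lemma circle_int_boundary m n :
  circle_int (fun t => (C + r%:C * cis t) ^+ m * (conjc (C + r%:C * cis t)) ^+ n.+1 * (r%:C * cis t)) =
  \sum_(0 <= i < minn n.+1 m.+1) boundary_coef m n.+1 i i.+1 * (2 * pi)%:C.
Proof.
have mA := @measurable_angles R.
have ci (k : int) (x : R[i]) : cintegrable mu angles (fun t => x * cis (k%:~R * t)).
  by apply: cintegrableZ => //; exact/ccontinuous_integrable_angles/ccontinuous_cis.
rewrite /circle_int; under [cintegral _ _ _]eq_cintegral => t _ do rewrite boundary_expansion.
rewrite cintegral_sum//; last first.
  by move=> i; apply: cintegrable_sum => // k; exact: ci.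
have E (i : nat) : cintegral mu angles (fun t => \sum_(k < n.+2)
    boundary_coef m n.+1 i k * cis ((i.+1%:Z - k%:Z)%:~R * t)) =
    if (i < n.+1)%N then boundary_coef m n.+1 i i.+1 * (2 * pi)%:C else 0.
  rewrite cintegral_sum//.
  under eq_bigr => k _.
    rewrite cintegralZ//; last exact/ccontinuous_integrable_angles/ccontinuous_cis.
    rewrite -/(circle_int _) circle_int_cis subr_eq0 eqz_nat.
    over.
  rewrite -(big_mkord xpredT (fun k => boundary_coef m n.+1 i k *
    (if i.+1 == k then (2 * pi)%:C else 0))).
  rewrite (eq_bigr (fun k => if k == i.+1 then boundary_coef m n.+1 i k * (2 * pi)%:C else 0)).
    by rewrite -big_mkcond big_nat1_eq.
  by move=> k _; rewrite eq_sym; case: ifP => // _; rewrite mulr0.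
under eq_bigr => i _ do rewrite E.
rewrite -(big_mkord xpredT (fun i => if (i < n.+1)%N then boundary_coef m n.+1 i i.+1 * (2 * pi)%:C else 0)).
rewrite -big_mkcond /= [RHS](big_nat_widen _ _ m.+1) ?geq_minr//.
rewrite [LHS]big_nat_cond [RHS]big_nat_cond; apply: eq_bigl => i /=.
by rewrite leq_min; case: (i < m.+1)%N; rewrite ?andbF ?andbT.
Qed.

(** The 2 produced by [dbar 1] on conj(z) cancels the one of 2 pi, which leaves [pi] on the
    right. *)
Lemma disk_moment m n :
  n.+1%:R * cintegral plane_measure (rdisk a b r)
    (fun p => zeta 1 p ^+ m * zeta (-1) p ^+ n) =
  \sum_(0 <= i < minn n.+1 m.+1) boundary_coef m n.+1 i i.+1 * pi%:C.
Proof.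
have s1 := @csmooth_zetaX R 1 m; have s2 := @csmooth_zetaX R (-1) n.+1.
have E : cintegral plane_measure (rdisk a b r)
    (dbar 1 (fun p => zeta 1 p ^+ m * zeta (-1) p ^+ n.+1)) =
    \sum_(0 <= i < minn n.+1 m.+1) boundary_coef m n.+1 i i.+1 * (2 * pi)%:C.
  rewrite -circle_int_boundary green_dbar//; [|by left|exact: csmoothM].
  by apply: eq_cintegral => t _; rewrite mul1r zetaN1_conj zeta1_circle.
have two0 : (2 : R[i]) != 0 by rewrite pnatr_eq0.
apply: (mulfI two0); rewrite mulr_sumr.
transitivity (cintegral plane_measure (rdisk a b r)
  (dbar 1 (fun p => zeta 1 p ^+ m * zeta (-1) p ^+ n.+1))).
  have mD := @measurable_rdisk R a b r.
  rewrite mulrA -cintegralZ//; last first.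
    apply: ccontinuous_integrable_rdisk => //; apply: csmooth_ccontinuous.
    by apply: csmoothM; exact: csmooth_zetaX.
  apply: eq_cintegral => p _; rewrite dbarM// dbar_zetaX.
  have -> : dbar 1 (fun p => zeta 1 p ^+ m) p = 0.
    case: m {s1 E} => [|m]; first by rewrite /dbar !cpartial_cst mulr0 addr0.
    by rewrite dbar_zetaX mulr1 subrr mulr0.
  have -> : (1 - 1 * -1 : R)%:C = 2 by rewrite mulrN1 opprK rmorphD.
  by ring.
rewrite {}E; apply: eq_bigr => i _.
by rewrite rmorphM /= rmorph_nat mulrCA.
Qed.

End Moments.

(** * Matrix entries as integrals of products of gradients *)

Section MatrixEntries.
Context {R : realType}.
Local Notation plane := (R * R)%type.
Local Notation K := ((Num.sqrt (2 * pi))^-1 : R).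

(* The harmonic function with Neumann data [fourier n], n <> 0, is
   z^|n| / |n| or its conjugate up to the factor [K]; this is its gradient. *)
Definition fourier_gradient (n : int) : plane -> R[i] * R[i] :=
  monomial_gradient (sgz n)%:~R `|n|%N.-1 K%:C.

Lemma sgz_sign (n : int) : n != 0 -> (sgz n)%:~R = 1 :> R \/ (sgz n)%:~R = -1 :> R.
Proof.
rewrite -sgz_eq0; case: (sgzP n) => // _ _; first by left.
by right; rewrite mulrNz.
Qed.

Lemma fourier_neumann_data (n : int) : n != 0 ->
  fourier n = neumann_data (sgz n)%:~R `|n|%N.-1 K%:C :> (R -> R[i]).
Proof.
move=> n0; apply/funext => t; rewrite /fourier /neumann_data; congr (_ * cis _).
rewrite prednK ?absz_gt0// mulrA; congr (_ * _).
by rewrite -[(`|n|%N)%:R]/((`|n|%N : int)%:~R) -intrM {1}[n]intEsg.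
Qed.

(** The defining identity of the derivative is applied to the explicit solutions; the indicator
    restricts the integral to the small disk, which lies in the unit disk. *)
Lemma matrix_rep_gradient (a b r : R) (T : (R -> R[i]) -> R -> R[i]) (n m : int) :
  0 < r -> rdisk a b r `<=` unit_disk ->
  is_NtD_derivative (\1_(rdisk a b r) : plane -> R) T -> n != 0 -> m != 0 ->
  matrix_rep T n m = - cintegral plane_measure (rdisk a b r)
    (fun p => cdot (fourier_gradient m p) (fourier_gradient n p)).
Proof.
move=> r0 BD [_ TE] n0 m0; rewrite /matrix_rep.
have sol k (k0 : k != 0) := monomial_neumann_solution `|k|%N.-1 K%:C (sgz_sign k0).
have L2d k (k0 : k != 0) := neumann_data_L2diamond `|k|%N.-1 K%:C (sgz_sign k0).
rewrite (fourier_neumann_data n0) (fourier_neumann_data m0).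
rewrite (TE _ _ _ _ _ _ (L2d _ m0) (L2d _ n0) (sol _ m0) (sol _ n0)); congr (- _).
rewrite -[in RHS](setIidr BD); apply: complex_eqP => /=; rewrite Rintegral_mkcondr;
  apply: eq_Rintegral => p _; rewrite patchE indicE ?(Re_mul, Im_mul) /=;
  by case: (p \in _); rewrite ?mul1r ?mul0r ?subr0 ?addr0.
Qed.

Lemma csmooth_cdot_gradient (n m : int) :
  csmooth (fun p => cdot (fourier_gradient m p) (fourier_gradient n p)).
Proof.
have sg k : csmooth (fun p => (fourier_gradient k p).1) /\ csmooth (fun p => (fourier_gradient k p).2).
  have s1 : csmooth (fun p => K%:C * zeta (sgz k)%:~R p ^+ `|k|%N.-1).
    by apply: csmoothM; [exact: csmooth_cst|exact: csmooth_zetaX].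
  by split => //; apply: csmoothM => //; exact: csmooth_cst.
have [m1 m2] := sg m; have [n1 n2] := sg n.
have [u1 u2] := csmoothM m1 (csmooth_conj n1); have [v1 v2] := csmoothM m2 (csmooth_conj n2).
split; rewrite /cdot.
  by under eq_fun do rewrite Re_add; exact: smoothD.
by under eq_fun do rewrite Im_add; exact: smoothD.
Qed.

Lemma conjcM (x y : R[i]) : conjc (x * y) = conjc x * conjc y.
Proof. exact: rmorphM. Qed.

Lemma conjc_invol (x : R[i]) : conjc (conjc x) = x.
Proof. by case: x => a b /=; rewrite opprK. Qed.

Lemma conjcX (x : R[i]) n : conjc (x ^+ n) = conjc x ^+ n.
Proof. exact: rmorphXn. Qed.

Lemma conjc_real (x : R) : conjc x%:C = x%:C.
Proof. by apply: complex_eqP; rewrite !ReImE /= ?oppr0. Qed.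

Lemma cdot_conj (x y : R[i] * R[i]) : conjc (cdot x y) = cdot y x.
Proof. by apply: complex_eqP; rewrite /cdot !ReImE; ring. Qed.

Lemma cdot_conj2 (x y : R[i] * R[i]) :
  cdot (conjc x.1, conjc x.2) (conjc y.1, conjc y.2) = conjc (cdot x y).
Proof. by apply: complex_eqP; rewrite /cdot /= !ReImE; ring. Qed.

(** Negating the index only flips the sign [s], the amplitude being real; the centrohermitian
    symmetry rests on this. *)
Lemma fourier_gradientN (n : int) (p : plane) :
  fourier_gradient (- n) p = (conjc (fourier_gradient n p).1, conjc (fourier_gradient n p).2).
Proof.
rewrite /fourier_gradient /monomial_gradient abszN sgzN mulrNz /=.
have zN s : zeta (- s) p = conjc (zeta s p).
  by apply: complex_eqP; rewrite !ReImE /= ?mulNr.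
have iN s : 0 +i* (- s) = conjc (0 +i* s) :> R[i] by [].
by rewrite zN iN !conjcM !conjcX conjc_real.
Qed.

(* [cdot] is elaborated with the conjugation of numClosedFieldType. *)
Lemma cdotE (x y : R[i] * R[i]) : cdot x y = x.1 * conjc y.1 + x.2 * conjc y.2.
Proof. by []. Qed.

Lemma fourier_gradient_pos (n : nat) (p : plane) : fourier_gradient n.+1%:Z p =
  (K%:C * zeta 1 p ^+ n, K%:C * zeta 1 p ^+ n * (0 +i* 1)).
Proof. by []. Qed.

(** The vectors (1, i) and (1, - i) are orthogonal for the Hermitian product: 1 + i^2 = 0. *)
Lemma cdot_gradient_opp (n m : nat) (p : plane) :
  cdot (fourier_gradient n.+1%:Z p) (fourier_gradient (- m.+1%:Z) p) = 0.
Proof.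
rewrite fourier_gradientN cdotE !fourier_gradient_pos.
have i2 : (0 +i* 1) * (0 +i* 1) = -1 :> R[i].
  by apply: complex_eqP; rewrite !ReImE /= ?mul0r ?mulr0 ?mulr1 ?addr0 ?sub0r ?oppr0.
by rewrite !conjc_invol [X in _ + X]mulrACA i2 mulrN1 subrr.
Qed.

(** The constant is [K] squared, which is 1 / (2 pi), times the squared length 2 of (1, i). *)
Lemma cdot_gradient_pos (n m : nat) (p : plane) :
  cdot (fourier_gradient m.+1%:Z p) (fourier_gradient n.+1%:Z p) =
  (pi^-1)%:C * (zeta 1 p ^+ m * zeta (-1) p ^+ n).
Proof.
have pi0 := pi_gt0 R.
have K2 : K%:C * K%:C = ((2 * pi)^-1)%:C :> R[i].
  by rewrite -rmorphM /= -invfM -expr2 sqr_sqrtr// mulr_ge0// ltW.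
rewrite cdotE !fourier_gradient_pos.
have i2 : (0 +i* 1) * conjc (0 +i* 1) = 1 :> R[i].
  by apply: complex_eqP; rewrite !ReImE /=; ring.
rewrite /= !conjcM !conjcX conjc_real [X in _ + X]mulrACA i2 mulr1 -mulr2n mulrACA K2 -zetaN1_conj -mulrnAl.
congr (_ * _); apply: complex_eqP; rewrite mulr2n !ReImE /= ?addr0//.
have : pi != 0 :> R by rewrite gt_eqF.
by move: pi => x x0; field.
Qed.

End MatrixEntries.

(** * The entries for a disk whose centre is given in polar form *)

Section DiskEntry.
Context {R : realType}.
Variables (c t r : R).
Local Notation C := (c * cos t +i* (c * sin t)).

Lemma polar_center : c%:C * cis t = C.
Proof. by apply: complex_eqP; rewrite !ReImE /=; ring. Qed.

Lemma rdisk_unit_disk : 0 <= c -> 0 < r -> r < 1 - c ->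
  rdisk (c * cos t) (c * sin t) r `<=` unit_disk.
Proof.
move=> c0 r0 rc p; rewrite -disk_rdisk// => pC.
have {}pC : normc (toC p - C) < r := pC.
suff : normc (toC p - 0) < 1 by [].
rewrite subr0 -[toC p](subrK C); apply: le_lt_trans (le_normcD _ _) _.
have -> : normc C = c.
  by rewrite -polar_center normcM /= cos2Dsin2 sqrtr1 mulr1 expr0n addr0 sqrtr_sqr ger0_norm.
by move: pC; rewrite -ltrBrDr => /lt_trans; apply; lra.
Qed.

(** The phases of the centre combine to (m - i) - (n - i) = m - n. The identity (n+1) C(n, i) =
    (i+1) C(n+1, i+1) produces the factor 1 / (i+1), together with a factor n+1 that matches the one
    in [disk_moment]. *)
Lemma boundary_coef_polar (m n i : nat) : (i <= m)%N -> (i <= n)%N ->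
  boundary_coef (c * cos t) (c * sin t) r m n.+1 i i.+1 =
  n.+1%:R * (cis ((m.+1%:R - n.+1%:R) * t) *
  (i.+1%:R^-1 * ('C(m, i))%:R * ('C(n, i))%:R *
   c ^+ (m.+1 + n.+1 - 2 * i - 2) * r ^+ (2 * i + 2))%:C).
Proof.
move=> im il; rewrite /boundary_coef -polar_center subSS.
have -> : conjc (c%:C * cis t) = c%:C * cis (- t) by rewrite conjcM conjc_real cisN.
rewrite !exprMn !cisX.
have -> : (i + i.+1).+1 = (2 * i + 2)%N by lia.
have -> : (m.+1 + n.+1 - 2 * i - 2 = (m - i) + (n - i))%N by lia.
have -> : (m.+1%:R - n.+1%:R) * t = (m - i)%:R * t + (n - i)%:R * - t.
  by rewrite !natrB// -!natr1; ring.
have bin : 'C(n.+1, i.+1)%:R = (n.+1%:R * (i.+1%:R^-1 * 'C(n, i)%:R))%:C :> R[i].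
  have i0 : (i.+1%:R : R) != 0 by rewrite pnatr_eq0.
  have /(congr1 (fun k => k%:R : R)) := mul_bin_diag n.+1 i.
  rewrite !natrM /= => E; rewrite mulrCA E mulrA mulVf// mul1r.
  by rewrite rmorph_nat.
rewrite bin cisD !rmorphM !rmorphXn /= !rmorph_nat [c%:C ^+ (_ + _)]exprD.
move: (cis _) (cis _) (c%:C ^+ _) (c%:C ^+ _) (r%:C ^+ _) => x1 x2 x3 x4 x5.
by ring.
Qed.

Lemma matrix_rep_pos (T : (R -> R[i]) -> R -> R[i]) (n m : nat) :
  0 < r -> rdisk (c * cos t) (c * sin t) r `<=` unit_disk ->
  is_NtD_derivative (\1_(rdisk (c * cos t) (c * sin t) r) : R * R -> R) T ->
  matrix_rep T n.+1%:Z m.+1%:Z = - cis ((m.+1%:R - n.+1%:R) * t) *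
   (\sum_(0 <= k < minn n.+1 m.+1)
     (k.+1%:R)^-1 * ('C(m, k))%:R * ('C(n, k))%:R
      * c ^+ (m.+1 + n.+1 - 2 * k - 2) * r ^+ (2 * k + 2))%:C.
Proof.
move=> r0 BD hT; rewrite (matrix_rep_gradient r0 BD hT)// mulNr; congr (- _).
have mD := @measurable_rdisk R (c * cos t) (c * sin t) r.
transitivity ((pi^-1)%:C * cintegral plane_measure (rdisk (c * cos t) (c * sin t) r)
    (fun p => zeta 1 p ^+ m * zeta (-1) p ^+ n)).
  rewrite -cintegralZ//; last first.
    apply: ccontinuous_integrable_rdisk => //; apply: csmooth_ccontinuous.
    by apply: csmoothM; exact: csmooth_zetaX.
  by apply: eq_cintegral => p _; exact: cdot_gradient_pos.
have n0 : (n.+1%:R : R[i]) != 0 by rewrite pnatr_eq0.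
(* Multiplying by [n.+1] brings in the moment formula; its [pi] cancels the 1 / pi of the
   gradients. *)
apply: (mulfI n0); rewrite mulrCA disk_moment// -mulr_suml mulrCA -rmorphM /=.
rewrite mulVf ?gt_eqF ?pi_gt0// mulr1 rmorph_sum /= mulr_sumr mulr_sumr.
apply: eq_big_nat => i /andP[_]; rewrite leq_min !ltnS => /andP[il im].
exact: boundary_coef_polar.
Qed.

End DiskEntry.

Theorem proposition3p2 (R : realType) (c zeta r : R)
    (T : (R -> R[i]) -> R -> R[i])
    (hc0 : 0 <= c) (hc1 : c < 1) (hr0 : 0 < r) (hr1 : r < 1 - c)
    (hT : is_NtD_derivative (\1_(disk (c%:C * cis zeta) r) : R * R -> R) T) :
  [/\ (forall n m : int, n != 0 -> m != 0 ->
         matrix_rep T n m = (matrix_rep T m n)^*),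
      (forall n m : int, n != 0 -> m != 0 ->
         matrix_rep T n m = (matrix_rep T (- n) (- m))^*),
      (forall n m : int, (n < 0 /\ 0 < m) \/ (0 < n /\ m < 0) ->
         matrix_rep T n m = 0) &
      (forall n m : nat, (0 < n)%N -> (0 < m)%N ->
         matrix_rep T n%:Z m%:Z =
         - cis ((m%:R - n%:R) * zeta) *
           (\sum_(0 <= k < minn n m)
              (k.+1%:R)^-1 * ('C(m.-1, k))%:R * ('C(n.-1, k))%:R
              * c ^+ (m + n - 2 * k - 2) * r ^+ (2 * k + 2))%:C)].
Proof.
move: hT; rewrite polar_center disk_rdisk// => hT.
have BD := @rdisk_unit_disk R c zeta r hc0 hr0 hr1.
have mD := @measurable_rdisk R (c * cos zeta) (c * sin zeta) r.
have ci n m := ccontinuous_integrable_rdisk (c * cos zeta) (c * sin zeta) hr0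
  (csmooth_ccontinuous (csmooth_cdot_gradient n m)).
have E n m := @matrix_rep_gradient R _ _ r T n m hr0 BD hT.
have conjN (x : R[i]) : conjc (- x) = - conjc x by case: x.
have hermitian n m : n != 0 -> m != 0 -> matrix_rep T n m = conjc (matrix_rep T m n).
  move=> n0 m0; rewrite !E// conjN -cintegral_conj//.
  by congr (- _); apply: eq_cintegral => p _; rewrite cdot_conj.
have opp n m (p : R * R) : 0 < n -> m < 0 ->
    cdot (fourier_gradient n p) (fourier_gradient m p) = 0.
  case: n => [[//|n]|//] _; case: m => [//|m] _.
  by rewrite NegzE; exact: cdot_gradient_opp.
have block n m : n < 0 -> 0 < m -> matrix_rep T n m = 0.
  move=> n0 m0; rewrite E ?(lt_eqF n0) ?(gt_eqF m0)//.
  under [cintegral _ _ _]eq_cintegral => p _ do rewrite opp//.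
  by rewrite cintegral0 ?oppr0.
split.
- exact: hermitian.
(* Negating both indices conjugates both gradients, hence conjugates their product. *)
- move=> n m n0 m0; rewrite !E ?oppr_eq0// conjN -cintegral_conj//.
  congr (- _); apply: eq_cintegral => p _.
  by rewrite !fourier_gradientN cdot_conj2 conjc_invol.
(* The block with [n] positive and [m] negative follows from the other one by Hermitian symmetry. *)
- move=> n m [[n0 m0]|[n0 m0]]; first exact: block.
  rewrite hermitian ?(gt_eqF n0) ?(lt_eqF m0)// block//.
  by apply: complex_eqP; rewrite ?(Re_cconj, Im_cconj) /= ?oppr0.
- by move=> [//|n] [//|m] _ _; exact: matrix_rep_pos.
Qed.
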